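(* Let $\sigma>0$, let $I$ be a bounded interval, and let $$a_\sigma=\frac{2(1+e^{-\sigma})e^{-\sigma}}{(1-e^{-\sigma})^3},\qquad b_\sigma=\frac{2(1+e^{-\sigma})}{1-e^{-\sigma}}.$$ Let $E_\varepsilon^\sigma$ be the functional $$E^\sigma_\varepsilon(u,v;I)=\varepsilon\sum_{i\in\mathcal I^*_\varepsilon(I)}f\Big(\frac{u_i-u_{i-1}}\varepsilon\Big)+\frac{a_\sigma}\varepsilon\sum_{i\in\mathcal I^*_\varepsilon(I)}(v_i-v_{i-1})^2+\frac{b_\sigma}\varepsilon\sum_{i\in\mathcal I^*_\varepsilon(I)}(u_i-v_i)^2,\qquad u,v\in\mathcal A_\varepsilon(I).$$ Then, as $\varepsilon\to0$, the sequence $E_\varepsilon^\sigma$ $\Gamma$-converges (with respect to the convergence $u^\varepsilon\to u$ and $v^\varepsilon\to u$ in $L^2(I)$) to the same $\Gamma$-limit as the sequence $$F^\sigma_\varepsilon(u;I)=\varepsilon\sum_{i\in\mathcal I^*_\varepsilon(I)}f\Big(\frac{u_i-u_{i-1}}\varepsilon\Big)+\varepsilon\sum_{i,j\in\mathcal I_\varepsilon(I)}e^{-\sigma|i-j|}\Big(\frac{u_i-u_j}\varepsilon\Big)^2,\qquad u\in\mathcal A_\varepsilon(I)$$ (the latter with respect to $L^2(I)$-convergence).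
   Context: $f:\mathbb R\to[0,+\infty)$ satisfies $0\le f(z)\le c(z^2+1)$ for some $c>0$. For $\varepsilon>0$: $\mathcal I_\varepsilon(I)=\{i\in\mathbb Z:\varepsilon i\in I\}$, $\mathcal I^*_\varepsilon(I)=\{i\in\mathbb Z:\varepsilon i,\varepsilon(i-1)\in I\}$, $\mathcal A_\varepsilon(I)=\{u:\varepsilon\mathcal I_\varepsilon(I)\to\mathbb R\}$, $u_i=u(\varepsilon i)$. Discrete functions are identified with their piecewise-constant extensions to $I$, and the functionals are extended by $+\infty$ to $L^2$ functions that are not of this form. The $\Gamma$-limit of $E^\sigma_\varepsilon$ is a functional of the single function $u$: both components $u^\varepsilon$ and $v^\varepsilon$ are required to converge in $L^2(I)$ to the same limit $u$. *)

(* Defs.v *)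
From HB Require Import structures.
From mathcomp Require Import all_boot all_order all_algebra.
From mathcomp Require Import all_classical all_reals all_analysis.

Set Implicit Arguments.
Unset Strict Implicit.
Unset Printing Implicit Defensive.

Import Order.TTheory GRing.Theory Num.Theory.
Import numFieldNormedType.Exports.

Local Open Scope classical_set_scope.
Local Open Scope ring_scope.

Section GammaConvergence.
Context {R : realType} {X Y : Type}.

(* Sequential Gamma-convergence, as eps -> 0+, of the functionals [F eps] on
   [X] to [G] on [Y]: [conv x y] says that the sequence [x] in [X] converges to
   [y].  The usual notion is [X = Y]; [X] and [Y] are kept distinct for
   functionals of pairs whose two components converge to the same limit. *)
Definition Gamma_cvg (conv : (nat -> X) -> Y -> Prop)
    (F : R -> X -> \bar R) (G : Y -> \bar R) : Prop :=
  forall eps : nat -> R, (forall k, 0 < eps k) -> eps @ \oo --> (0 : R) ->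
  forall y : Y,
    (forall x : nat -> X, conv x y ->
       (G y <= limn_einf (fun k => F (eps k) (x k)))%E) /\
    (exists x : nat -> X, conv x y /\
       (limn_esup (fun k => F (eps k) (x k)) <= G y)%E).

End GammaConvergence.

Section L2.
Context {R : realType}.

Definition lebesgue_on (I : interval R) :
    {measure set (measurableTypeR R) -> \bar R} :=
  mrestr (@lebesgue_measure R) (measurable_itv I).

(* Elements are functions, not classes; everything below depends on them only
   up to equality a.e. in [I]. *)
Definition L2 (I : interval R) := LfunType (lebesgue_on I) (lee1n 2).

Definition L2_cvg (I : interval R) (u : nat -> L2 I) (l : L2 I) : Prop :=
  (fun k => 'N[lebesgue_on I]_2[EFin \o (fun x => (u k x - l x)%R)])%E
    @ \oo --> (0 : \bar R)%E.

Definition L2_pair_cvg (I : interval R) (w : nat -> L2 I * L2 I) (l : L2 I) :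
    Prop :=
  L2_cvg (fun k => (w k).1) l /\ L2_cvg (fun k => (w k).2) l.

End L2.

Section DiscreteEnergies.
Context {R : realType}.
Implicit Types (f : R -> R) (sigma eps : R) (I : interval R).

Definition nodes eps I : set int := [set i | eps * i%:~R \in I].

Definition bonds eps I : set int :=
  [set i | nodes eps I i /\ nodes eps I (i - 1)].

(* A function on the set of nodes is given by [u : int -> R], [u i] being the
   value at [eps * i]; values of [u] outside [nodes eps I] are never used. *)

Definition local_energy f eps I (u : int -> R) : R :=
  eps * \sum_(i \in bonds eps I) f ((u i - u (i - 1)) / eps).

Definition nonlocal_energy f sigma eps I (u : int -> R) : R :=
  local_energy f eps I u +
  eps * \sum_(i \in nodes eps I) \sum_(j \in nodes eps I)
          expR (- (sigma * `|i - j|%:~R)) * ((u i - u j) / eps) ^+ 2.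

Definition a_coef sigma : R :=
  2 * (1 + expR (- sigma)) * expR (- sigma) / (1 - expR (- sigma)) ^+ 3.

Definition b_coef sigma : R :=
  2 * (1 + expR (- sigma)) / (1 - expR (- sigma)).

Definition two_field_energy f sigma eps I (u v : int -> R) : R :=
  local_energy f eps I u +
  a_coef sigma / eps * \sum_(i \in bonds eps I) (v i - v (i - 1)) ^+ 2 +
  b_coef sigma / eps * \sum_(i \in bonds eps I) (u i - v i) ^+ 2.

(* [U] is a.e. in [I] the piecewise-constant extension of [u]: it takes the
   value [u i] at the points of [I] whose nearest node is [eps * i].  Every
   node of a nondegenerate [I] has a cell of positive measure, so [U]
   determines [u] on [nodes eps I]. *)
Definition pc_extension eps I (u : int -> R) (U : R -> R) : Prop :=
  {ae lebesgue_on I, forall x : R, forall i : int, nodes eps I i ->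
     (forall j : int, nodes eps I j ->
        `|x - eps * i%:~R| <= `|x - eps * j%:~R|) ->
     U x = u i}.

(* The infima below are over a set with at most one value when [I] is
   nondegenerate and contains a node, and are +oo when no discrete function
   extends to the given argument. *)
Definition F_functional f sigma I eps (U : L2 I) : \bar R :=
  ereal_inf [set e | exists u : int -> R,
    pc_extension eps I u U /\ e = (nonlocal_energy f sigma eps I u)%:E].

Definition E_functional f sigma I eps (W : L2 I * L2 I) : \bar R :=
  ereal_inf [set e | exists u v : int -> R,
    [/\ pc_extension eps I u W.1, pc_extension eps I v W.2 &
        e = (two_field_energy f sigma eps I u v)%:E]].

End DiscreteEnergies.

(* Main.v *)
Require Import Defs.
From HB Require Import structures.
From mathcomp Require Import all_boot all_order all_algebra.
From mathcomp Require Import all_classical all_reals all_analysis.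
From mathcomp Require Import measurable_realfun.
From mathcomp Require Import ring lra zify.

Set Implicit Arguments.
Unset Strict Implicit.
Unset Printing Implicit Defensive.

Import Order.TTheory GRing.Theory Num.Theory.
Import numFieldNormedType.Exports.

Local Open Scope classical_set_scope.
Local Open Scope ring_scope.

(** With q = exp (- sigma), the nonlocal quadratic form is what is left of the
    two-field quadratic form when the auxiliary field is minimized out: on the
    whole line,
      sum_(i, j) q^|i - j| (W_i - W_j)^2
        = min_Z sum_n a (Z_(n+1) - Z_n)^2 + b (W_n - Z_n)^2
    holds exactly for the given a = a_sigma and b = b_sigma.  On a finite
    interval of nodes this becomes two inequalities, both read off one exact
    dynamic-programming step ([value_step]).  The nonlocal form is below the
    two-field form whenever the two fields agree at both ends
    ([pair_sum_le_two_field]); conversely some Z brings the two-field form down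
    to the nonlocal form, up to a boundary layer seen from the two end nodes
    ([two_field_le_pair_sum]).  Averaging over K candidate end nodes makes the
    boundary layer O(1/K) of the energy ([cut_ends]).

    Existence of the Gamma-limit is obtained without any integral formula.
    Call lower limit of a family of functionals at y the limit, as tau -> 0, of
    the infimum of the values at parameters eps < tau and arguments tau-close to
    y.  It bounds the liminf of any sequence converging to y.  The point is to
    show that if one family takes values below M at arbitrarily small eps and
    arbitrarily close to y, then the other one takes values at most M', for any M' > M,
    close to y for all small eta ([transfer_F_E], [transfer_E_F]).  This gives
    equality of the two lower limits and recovery sequences for both families
    along every eta -> 0, hence one common Gamma-limit.

    To pass from one eps to all small eta, a profile (u, v) on the eps-grid is
    made into a profile on the eta-grid by tiling ([tiling]).  With the values
    u_i / eps, the two-field energy is eps times a sum over bonds whose terms no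
    longer contain eps.  The nodes are cut into blocks of K bonds; on the eta-grid each block
    is replaced by k ~ eps / eta consecutive copies of its increments, so that
    the k copies together cover the length and the rise of the block.  The
    field v need not match at the junctions of copies, so it is first set equal
    to u at the block ends ([pinned]).  Choosing the offset of the blocks by
    averaging, this costs O(1/K) of the energy ([pinned_cost], [good_offset]).
    Because the tiled fields agree at both ends, the tiling has small energy for
    both functionals at once.

    A bound on the energy bounds the discrete Dirichlet integral, so by
    Cauchy-Schwarz the profile varies by O(sqrt (K eps)) over O(K) nodes
    ([oscillation_le]), and the tiled profile stays within this distance of the
    original one, uniformly.  Here K is fixed first, and eps small depending on
    K.  The two-field energy need not control u at the first node, where
    (u - v)^2 is not charged.  That node is dropped, and its cell contributes
    little to the L2 distance because the limit y has small norm on short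
    intervals ([l2_split_cell]). *)

Ltac nonneg := repeat first
  [ by [] | assumption | by apply: ltW | exact: sqr_ge0 | exact: expR_ge0
  | apply: addr_ge0 | apply: mulr_ge0 | rewrite invr_ge0 | apply: exprn_ge0
  | apply: sumr_ge0 => *].

(** * The exponential kernel and the two-field chain *)

Section ExponentialChain.
Context {R : realType} (q : R) (q_gt0 : 0 < q) (q_lt1 : q < 1).
Implicit Types (W Z : nat -> R) (x y z : R) (n N : nat).

(** [chain_a] and [chain_b] are the coefficients of the two-field energy as
    functions of q = exp (- sigma). *)
Definition chain_a : R := 2 * (1 + q) * q / (1 - q) ^+ 3.
Definition chain_b : R := 2 * (1 + q) / (1 - q).

(** The coupling term of a bond sits at its right node, as in the sum over bonds
    of the two-field energy. *)
Definition bond_quad W Z n : R :=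
  chain_a * (Z n.+1 - Z n) ^+ 2 + chain_b * (W n.+1 - Z n.+1) ^+ 2.

(** The interaction of a value x placed at node n with the nodes 0, ..., n. *)
Definition past_sum W n x : R := \sum_(i < n.+1) q ^+ (n - i) * (x - W i) ^+ 2.

Definition pair_sum W N : R :=
  \sum_(i < N.+1) \sum_(j < N.+1) q ^+ `|i - j|%N * (W i - W j) ^+ 2.

(** When W is prolonged to the left by the constant [W 0], the interaction of x
    with all nodes up to n is a quadratic polynomial in x: [past_mean] is its
    minimizer, [past_var] its minimum, and its leading coefficient is the full
    geometric sum 1 / (1 - q), whatever n; this polynomial is [past_cost]. *)
Fixpoint past_mean W n : R :=
  if n is m.+1 then q * past_mean W m + (1 - q) * W n else W 0%N.

Fixpoint past_var W n : R :=
  if n is m.+1 then q * past_var W m + q * (W n - past_mean W m) ^+ 2 else 0.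

Definition past_cost W n x : R := (x - past_mean W n) ^+ 2 / (1 - q) + past_var W n.

(** The least two-field energy of the nodes up to n when the auxiliary field has
    the value z at node n + 1, for W prolonged to the left by a constant.  It
    solves the Riccati recursion of [value_step]. *)
Definition value W n z : R :=
  \sum_(k < n) 2 * q * past_cost W k (W k.+1)
  + 2 * q / (1 - q) * past_var W n + chain_a * (1 - q) * (z - past_mean W n) ^+ 2.

Lemma oneBq_neq0 : 1 - q != 0. Proof. by rewrite subr_eq0 gt_eqF. Qed.
Lemma oneBq_gt0 : 0 < 1 - q. Proof. by rewrite subr_gt0. Qed.

Lemma chain_a_gt0 : 0 < chain_a.
Proof.
by rewrite /chain_a divr_gt0 ?exprn_gt0 ?oneBq_gt0// !mulr_gt0// addr_gt0.
Qed.

Lemma chain_b_gt0 : 0 < chain_b.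
Proof. by rewrite /chain_b divr_gt0 ?oneBq_gt0// !mulr_gt0// addr_gt0. Qed.

(** The Bellman equation with its remainder: minimizing over z selects
    z = q z' + (1 - q) [past_mean W n.+1], which cancels the square. *)
Lemma value_step W n z z' :
  value W n z + chain_b * (W n.+1 - z) ^+ 2 + chain_a * (z' - z) ^+ 2 =
  value W n.+1 z'
  + chain_a / q * (z - q * z' - (1 - q) * past_mean W n.+1) ^+ 2.
Proof.
have q0 : q != 0 by rewrite gt_eqF.
have q1 := oneBq_neq0.
rewrite /value big_ord_recr /past_cost /= /chain_a /chain_b.
field; by rewrite q1 q0.
Qed.

Lemma past_var_ge0 W n : 0 <= past_var W n.
Proof.
elim: n => [|n ih] //=; rewrite addr_ge0// mulr_ge0// ?sqr_ge0//; exact: ltW.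
Qed.

Lemma past_sumS W n x : past_sum W n.+1 x = q * past_sum W n x + (x - W n.+1) ^+ 2.
Proof.
rewrite /past_sum big_ord_recr /= subnn expr0 mul1r; congr (_ + _).
rewrite mulr_sumr; apply: eq_bigr => i _.
by rewrite subSn ?exprS ?mulrA// -ltnS.
Qed.

(** The second term is the contribution of the constant prolongation. *)
Lemma past_costE W n x :
  past_cost W n x = past_sum W n x + q ^+ n.+1 / (1 - q) * (x - W 0%N) ^+ 2.
Proof.
have q1 := oneBq_neq0.
elim: n => [|n ih].
  have -> : past_sum W 0 x = (x - W 0%N) ^+ 2.
    by rewrite /past_sum big_ord1 subnn expr0 mul1r.
  by rewrite /past_cost /= expr1; field.
rewrite past_sumS (exprS q n.+1).
have -> : past_cost W n.+1 x = q * past_cost W n x + (x - W n.+1) ^+ 2.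
  by rewrite /past_cost /=; field.
by rewrite ih; field.
Qed.

Lemma past_sum_le_cost W n x : past_sum W n x <= past_cost W n x.
Proof.
rewrite past_costE lerDl mulr_ge0 ?sqr_ge0// divr_ge0 ?exprn_ge0 ?ltW//.
exact: oneBq_gt0.
Qed.

Lemma pair_sumS W N :
  pair_sum W N.+1 = pair_sum W N + 2 * q * past_sum W N (W N.+1).
Proof.
have E (i : 'I_N.+1) : q ^+ `|i - N.+1|%N = q * q ^+ (N - i).
  have iN : (i <= N)%N by rewrite -ltnS.
  by rewrite distnEr ?leqW// subSn// exprS.
rewrite /pair_sum big_ord_recr /=.
under eq_bigr do rewrite big_ord_recr /=.
rewrite big_split /= [X in _ + X = _]big_ord_recr /=.
rewrite (subrr (W N.+1)) expr0n /= mulr0 addr0 -addrA.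
congr (_ + _); rewrite /past_sum mulr_sumr -big_split /=; apply: eq_bigr => i _.
by rewrite (distnC N.+1) E; ring.
Qed.

Lemma pair_sum0 W : pair_sum W 0 = 0.
Proof. by rewrite /pair_sum !big_ord1 (subrr (W _)) expr0n mulr0. Qed.

Lemma pair_sum_steps W N :
  pair_sum W N = \sum_(k < N) 2 * q * past_sum W k (W k.+1).
Proof.
by elim: N => [|N ih]; rewrite ?pair_sum0 ?big_ord0// pair_sumS ih big_ord_recr.
Qed.

(** By [value_step] the two-field energy of any Z dominates [value], which
    dominates the nonlocal energy of the nodes met so far together with their
    interaction with the next one.  Agreement at the ends pays for the start of
    the induction and for the last node. *)
Lemma pair_sum_le_two_field W Z N : Z 0%N = W 0%N -> Z N = W N ->
  pair_sum W N <= \sum_(n < N) bond_quad W Z n.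
Proof.
move=> Z0 ZN.
have key n : value W n (Z n.+1) <=
    \sum_(k < n) bond_quad W Z k + chain_a * (Z n.+1 - Z n) ^+ 2.
  elim: n => [|n ih].
    rewrite /value !big_ord0 /= Z0 mulr0 !add0r ler_wpM2r ?sqr_ge0//.
    have := chain_a_gt0; have := q_gt0; nra.
  rewrite big_ord_recr /= {2}/bond_quad.
  have := value_step W n (Z n.+1) (Z n.+2).
  have : 0 <= chain_a / q * (Z n.+1 - q * Z n.+2 - (1 - q) * past_mean W n.+1) ^+ 2.
    by rewrite mulr_ge0 ?sqr_ge0// divr_ge0 ?ltW// chain_a_gt0.
  lra.
case: N ZN => [_|N ZN]; first by rewrite pair_sum0 big_ord0.
rewrite big_ord_recr /= {2}/bond_quad -ZN subrr expr0n mulr0 addr0.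
apply: le_trans (key N).
rewrite pair_sumS pair_sum_steps -ZN /value.
rewrite -addrA lerD//.
  apply: ler_sum => i _; rewrite ler_pM2l ?past_sum_le_cost//.
  by rewrite mulr_gt0.
apply: (@le_trans _ _ (2 * q * past_cost W N (Z N.+1))).
  by rewrite ler_pM2l ?mulr_gt0// past_sum_le_cost.
rewrite /past_cost mulrDr /chain_a.
have v0 := past_var_ge0 W N.
have q1 := oneBq_gt0.
have s0 := sqr_ge0 (Z N.+1 - past_mean W N).
set s := _ ^+ 2 in s0 *; set v := past_var W N in v0 *.
rewrite -subr_ge0.
rewrite [leRHS](_ : _ = 2 * q ^+ 2 / (1 - q) * v + 4 * q ^+ 2 * s / (1 - q) ^+ 2).
  by nonneg.
by field; exact: oneBq_neq0.
Qed.

(** Backward recursion along the minimizers of [value_step]. *)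
Lemma value_attained W N z : exists Z, Z N.+1 = z /\
  \sum_(n < N) bond_quad W Z n + chain_a * (z - Z N) ^+ 2 <= value W N z.
Proof.
elim: N z => [|N ih] z.
  exists (fun=> z); split=> //; rewrite big_ord0 subrr expr0n mulr0 addr0.
  rewrite /value big_ord0 /= mulr0 !add0r mulr_ge0 ?sqr_ge0// ltW// mulr_gt0//.
    exact: chain_a_gt0.
  exact: oneBq_gt0.
have [Z [ZN le]] := ih (q * z + (1 - q) * past_mean W N.+1).
exists (fun n => if (n <= N.+1)%N then Z n else z); split; first by rewrite ltnn.
rewrite leqnn big_ord_recr /=.
rewrite (eq_bigr (fun n : 'I_N => bond_quad W Z n)); last first.
  move=> i _; rewrite /bond_quad; case: i => i /= iN.
  by rewrite !leqW//; lia.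
rewrite {2}/bond_quad leqnn leqnSn ZN.
have := value_step W N (q * z + (1 - q) * past_mean W N.+1) z.
rewrite [X in chain_a / q * X](_ : _ = 0) ?mulr0; last by ring.
lra.
Qed.

Definition end_sum W (N m : nat) : R := \sum_(j < N.+1) q ^+ `|j - m|%N * (W j - W m) ^+ 2.

(** The Z which is optimal for a given last value, taken equal to that of W; the
    excess is at most a multiple of the interaction of W with its constant
    prolongations beyond the two ends. *)
Lemma two_field_le_pair_sum : exists2 C : R, 0 < C & forall W N, exists Z,
  \sum_(n < N) bond_quad W Z n <=
  pair_sum W N + C * (end_sum W N 0 + end_sum W N N).
Proof.
have q1 := oneBq_gt0; have q1n := oneBq_neq0; have qn : q != 0 by rewrite gt_eqF.
pose k := 2 * q * (1 + q) / (1 - q).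
pose C := 2 * q / (1 - q) + k * (1 / q + 1 / (1 - q)).
have k0 : 0 < k by rewrite /k divr_gt0// !mulr_gt0// addr_gt0.
have c1 : 0 < 2 * q / (1 - q) by rewrite divr_gt0// mulr_gt0.
have c2 : 0 < k * (1 / q + 1 / (1 - q)).
  by rewrite mulr_gt0// addr_gt0// divr_gt0.
exists C; first by rewrite addr_gt0.
move=> W [|N].
  exists W; rewrite big_ord0 pair_sum0 add0r mulr_ge0//; last by nonneg.
  by rewrite ltW// addr_gt0.
(* The auxiliary field is required to reach W at the last node, where the
   coupling is then free. *)
have [Z [ZN le]] := value_attained W N (W N.+1).
exists Z; rewrite big_ord_recr /= {2}/bond_quad ZN subrr expr0n mulr0 addr0.
apply: le_trans le _.
set L := end_sum W N.+1 0; set Rr := end_sum W N.+1 N.+1.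
have LE : L = \sum_(j < N.+1) q ^+ j.+1 * (W j.+1 - W 0%N) ^+ 2.
  rewrite /L /end_sum big_ord_recl (subrr (W _)) expr0n mulr0 add0r.
  by apply: eq_bigr => i _; rewrite distn0.
have RE : Rr = q * past_sum W N (W N.+1).
  rewrite /Rr /end_sum big_ord_recr /= (subrr (W _)) expr0n mulr0 addr0.
  rewrite /past_sum mulr_sumr; apply: eq_bigr => i _.
  have iN : (i <= N)%N by rewrite -ltnS.
  by rewrite distnEr ?leqW// subSn// exprS -mulrA -(opprB (W i)) sqrrN.
have L0 : 0 <= L by apply: sumr_ge0 => i _; rewrite mulr_ge0 ?sqr_ge0 ?exprn_ge0 ?ltW.
have R0 : 0 <= Rr by apply: sumr_ge0 => i _; rewrite mulr_ge0 ?sqr_ge0 ?exprn_ge0 ?ltW.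
have lastL : q ^+ N.+1 * (W N.+1 - W 0%N) ^+ 2 <= Rr.
  rewrite /Rr /end_sum big_ord_recl (dist0n N.+1) -(opprB (W N.+1)) sqrrN lerDl.
  by nonneg.
have S_E : \sum_(n < N.+1) 2 * q * past_cost W n (W n.+1) =
    pair_sum W N.+1 + 2 * q / (1 - q) * L.
  rewrite pair_sum_steps LE mulr_sumr -big_split /=; apply: eq_bigr => i _.
  by rewrite past_costE; field.
have Sle : \sum_(n < N) 2 * q * past_cost W n (W n.+1) + 2 * q * past_cost W N (W N.+1) =
    pair_sum W N.+1 + 2 * q / (1 - q) * L by rewrite -S_E big_ord_recr.
have cost_ge0 : 0 <= past_cost W N (W N.+1).
  rewrite /past_cost addr_ge0 ?past_var_ge0// divr_ge0 ?sqr_ge0//; exact: ltW.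
have value_le : value W N (W N.+1) <=
    \sum_(n < N) 2 * q * past_cost W n (W n.+1) + k * past_cost W N (W N.+1).
  rewrite /value -addrA lerD2l /past_cost /k /chain_a.
  have v0 := past_var_ge0 W N.
  rewrite -subr_ge0.
  set s := (_ - past_mean _ _) ^+ 2; set v := past_var W N in v0 *.
  have -> : 2 * q * (1 + q) / (1 - q) * (s / (1 - q) + v) -
    (2 * q / (1 - q) * v + 2 * (1 + q) * q / (1 - q) ^+ 3 * (1 - q) * s) =
    2 * q ^+ 2 / (1 - q) * v by field.
  by rewrite mulr_ge0// divr_ge0 ?mulr_ge0 ?exprn_ge0// ltW.
have cost_le : past_cost W N (W N.+1) <= (1 / q + 1 / (1 - q)) * Rr.
  rewrite past_costE mulrDl lerD//.
    by rewrite RE -subr_ge0 le_eqVlt; apply/orP; left; apply/eqP; field.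
  by rewrite -mulrA mulrCA mul1r ler_pM2l ?invr_gt0.
have kc := ler_wpM2l (ltW k0) cost_le.
have kC : 0 <= 2 * q * past_cost W N (W N.+1).
  by rewrite !mulr_ge0// ltW.
have e1 : 0 <= 2 * q / (1 - q) * Rr by rewrite mulr_ge0// ltW.
have e2 : 0 <= k * (1 / q + 1 / (1 - q)) * L by rewrite mulr_ge0// ltW.
rewrite /C mulrA in kc *.
by lra.
Qed.

End ExponentialChain.

(** * Blocks and their periodic repetition *)

Section Blocks.
Context {R : numDomainType}.

Lemma sum_blocks (A B : nat) (g : nat -> R) :
  \sum_(n < A * B) g n = \sum_(l < A) \sum_(s < B) g (l * B + s)%N.
Proof.
elim: A => [|A ih]; first by rewrite mul0n !big_ord0.
by rewrite big_ord_recr /= -ih mulSnr big_split_ord.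
Qed.

Lemma sum_periodic (j K i : nat) (g : nat -> R) : (i < K)%N ->
  \sum_(s < j * K + i) g (s %% K)%N =
  j%:R * \sum_(s < K) g s + \sum_(s < i) g s.
Proof.
move=> iK; rewrite big_split_ord /=.
rewrite (sum_blocks j K (fun s => g (s %% K)%N)); congr (_ + _).
  rewrite (eq_bigr (fun=> \sum_(s < K) g s)) => [|l _].
    by rewrite sumr_const card_ord mulr_natl.
  by apply: eq_bigr => s _; rewrite modnMDl modn_small.
by apply: eq_bigr => s _; rewrite modnMDl modn_small// (ltn_trans _ iK).
Qed.

End Blocks.

Section Tiling.
Context {R : realType} (f : R -> R) (q : R) (U V : nat -> R) (r k K : nat).
Hypotheses (K_gt0 : (0 < K)%N) (k_gt0 : (0 < k)%N).

Definition density (W Z : nat -> R) n : R :=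
  f (W n.+1 - W n) + bond_quad q W Z n.

(** Bond t of the tiled profile copies the bond of the original profile whose
    left node is [source t]: the quotient selects one of the blocks of K bonds
    starting at node r, each of which is repeated k times. *)
Definition source (t : nat) : nat := (r + t %/ (k * K) * K + t %% K)%N.

(** The copies of a block can be joined because the two fields agree at its
    ends. *)
Definition pinned (n : nat) : R := if (K %| n - r)%N then U n else V n.

Definition tile (t : nat) : R :=
  \sum_(s < t) (U (source s).+1 - U (source s)).

(** The gap V - U is transported along [source], rather than the increments of V:
    these do not add up to those of U over a block. *)
Definition tile_aux (t : nat) : R :=
  tile t + (pinned (source t) - U (source t)).

Lemma source_node t : (K %| t)%N -> (K %| source t - r)%N.
Proof.
by move=> /eqP tK; rewrite /source tK addn0 addKn dvdn_mull.
Qed.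

(** The second case is a junction of two copies. *)
Lemma sourceS t : source t.+1 = (source t).+1 \/
  (K %| source t.+1 - r)%N /\ (K %| (source t).+1 - r)%N.
Proof.
have [tK|tK] := boolP (K %| t.+1)%N; [right|left].
  split; first exact: source_node.
  rewrite /source -addnS -addnA addKn dvdn_addr ?dvdn_mull//.
  by move: tK; rewrite /dvdn -addn1 -modnDml addn1.
rewrite /source modnS (negbTE tK) divnS ?muln_gt0 ?k_gt0//.
rewrite (_ : (_ %| _)%N = false) ?add0n ?addnS//.
by apply: contraNF tK; apply: dvdn_trans; rewrite dvdn_mull.
Qed.

Lemma tileS t : tile t.+1 - tile t = U (source t).+1 - U (source t).
Proof. by rewrite /tile big_ord_recr /= addrAC subrr add0r. Qed.

(** At a junction the transported gap is that of a block end, hence zero on both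
    sides, so junctions cost nothing. *)
Lemma density_tile t :
  density tile tile_aux t = density U pinned (source t).
Proof.
have gapS : pinned (source t.+1) - U (source t.+1) =
            pinned (source t).+1 - U (source t).+1.
  have [->//|[d1 d2]] := sourceS t.
  by rewrite /pinned d1 d2 !subrr.
rewrite /density tileS; congr (_ + _).
rewrite /bond_quad /tile_aux gapS; congr (_ * _ + _ * _); last by ring.
have := tileS t.
set x := tile t.+1; set y := tile t; set c := U (source t).+1 - U _ => xy.
by rewrite (_ : x = y + c); [rewrite /c; ring | rewrite -xy; ring].
Qed.

Lemma tile_aux_node t : (K %| t)%N -> tile_aux t = tile t.
Proof.
by move=> tK; rewrite /tile_aux /pinned source_node// subrr addr0.
Qed.

Lemma source_block l s : (s < k * K)%N ->
  source (l * (k * K) + s)%N = (r + l * K + s %% K)%N.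
Proof.
move=> skK; rewrite /source divnMDl ?muln_gt0 ?k_gt0// divn_small// addn0.
by rewrite mulnA modnMDl.
Qed.

Lemma sum_source (h : nat -> R) m :
  \sum_(t < m * (k * K)) h (source t) = k%:R * \sum_(n < m * K) h (r + n)%N.
Proof.
rewrite (sum_blocks m (k * K) (h \o source)) (sum_blocks m K (fun n => h (r + n)%N)).
rewrite mulr_sumr; apply: eq_bigr => l _.
rewrite (eq_bigr (fun s : 'I_(k * K) => h (r + l * K + s %% K)%N)); last first.
  by move=> s _ /=; rewrite source_block.
have := @sum_periodic _ k K 0 (fun s => h (r + l * K + s)%N) K_gt0.
rewrite addn0 big_ord0 addr0 => ->.
by congr (_ * _); apply: eq_bigr => s _; rewrite addnA.
Qed.

Lemma telescope_sum (g : nat -> R) c n :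
  \sum_(s < n) (g (c + s).+1 - g (c + s)%N) = g (c + n)%N - g c.
Proof.
elim: n => [|n ih]; first by rewrite big_ord0 addn0 subrr.
by rewrite big_ord_recr /= ih addnS; ring.
Qed.

Lemma tile_block l j i : (j < k)%N -> (i < K)%N ->
  tile (l * (k * K) + (j * K + i))%N =
  k%:R * (U (r + l * K)%N - U r) +
  j%:R * (U (r + l * K + K)%N - U (r + l * K)%N) +
  (U (r + l * K + i)%N - U (r + l * K)%N).
Proof.
move=> jk iK; rewrite /tile big_split_ord /= -addrA; congr (_ + _).
  rewrite (sum_source (fun n => U n.+1 - U n)); congr (_ * _).
  exact: telescope_sum.
pose g s := U (r + l * K + s).+1 - U (r + l * K + s)%N.
rewrite (eq_bigr (fun s : 'I_(j * K + i) => g (s %% K)%N)); last first.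
  move=> s _; rewrite source_block//.
  apply: leq_trans (ltn_ord s) _.
  apply: leq_trans (_ : (j.+1 * K <= _)%N).
    by rewrite mulSnr leq_add2l ltnW.
  by rewrite leq_mul2r jk orbT.
by rewrite sum_periodic// /g !telescope_sum.
Qed.

Lemma tile_end m : tile (m * (k * K))%N = k%:R * (U (r + m * K)%N - U r).
Proof.
rewrite /tile (sum_source (fun n => U n.+1 - U n)); congr (_ * _).
exact: telescope_sum.
Qed.

(** Since eta k is eps up to eta, the k copies of a block rise, in physical
    units, as much as the block; inside a block the tiled profile is
    controlled by the oscillation w of the profile. *)
Lemma tile_near (m : nat) (eta eps w : R) t :
  0 <= eta -> eta * k%:R <= eps -> eps <= eta * k%:R + eta ->
  (forall n n', (n <= r + m * K)%N -> (n' <= n)%N -> (n <= n' + K)%N ->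
     eps * `|U n - U n'| <= w) ->
  (t <= m * (k * K))%N ->
  `|eta * tile t + eps * U r - eps * U (r + t %/ (k * K) * K)%N| <=
  eta * `|U (r + t %/ (k * K) * K)%N - U r| + 2 * w.
Proof.
move=> eta0 keps epsk osc tm.
have kK0 : (0 < k * K)%N by rewrite muln_gt0 k_gt0.
have w0 : 0 <= w.
  apply: le_trans (osc 0%N 0%N _ _ _) => //; rewrite mulr_ge0//.
  by apply: le_trans keps; rewrite mulr_ge0.
have eps0 : 0 <= eps by apply: le_trans keps; rewrite mulr_ge0.
set l := (t %/ (k * K))%N.
have main : `|eta * k%:R * (U (r + l * K)%N - U r) - eps * (U (r + l * K)%N - U r)|
    <= eta * `|U (r + l * K)%N - U r|.
  rewrite -mulrBl normrM ler_wpM2r// ler_norml; apply/andP; split; lra.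
move: tm; rewrite leq_eqVlt => /predU1P[tE|tm].
  have lE : l = m by rewrite /l tE mulnK.
  rewrite tE tile_end -lE mulrA.
  rewrite [X in `|X|](_ : _ = eta * k%:R * (U (r + l * K)%N - U r) -
    eps * (U (r + l * K)%N - U r)); last by ring.
  by apply: (le_trans main); rewrite lerDl mulr_ge0.
have lm : (l < m)%N by rewrite ltn_divLR.
set s := (t %% (k * K))%N.
have sk : (s < k * K)%N by rewrite ltn_mod.
have tE : t = (l * (k * K) + (s %/ K * K + s %% K))%N by rewrite -divn_eq -divn_eq.
have jk : (s %/ K < k)%N by rewrite ltn_divLR.
have iK : (s %% K < K)%N by rewrite ltn_mod.
have lK : (l * K + K <= m * K)%N by rewrite -mulSnr leq_mul2r lm orbT.
rewrite [in tile t]tE tile_block//.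
set i := (s %% K)%N in iK *; set j := (s %/ K)%N in jk *.
have o1 : eps * `|U (r + l * K + K)%N - U (r + l * K)%N| <= w.
  by apply: osc; lia.
have o2 : eps * `|U (r + l * K + i)%N - U (r + l * K)%N| <= w.
  by apply: osc; lia.
have b1 : `|eta * (j%:R * (U (r + l * K + K)%N - U (r + l * K)%N))| <= w.
  apply: le_trans o1; rewrite mulrA normrM ler_wpM2r// ger0_norm ?mulr_ge0//.
  by apply: le_trans keps; rewrite ler_wpM2l// ler_nat ltnW.
have b2 : `|eta * (U (r + l * K + i)%N - U (r + l * K)%N)| <= w.
  apply: le_trans o2; rewrite normrM ler_wpM2r// ger0_norm//.
  apply: le_trans keps; rewrite ler_peMr//.
  by rewrite ler1n.
rewrite [X in `|X|](_ : _ = (eta * k%:R * (U (r + l * K)%N - U r) -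
    eps * (U (r + l * K)%N - U r)) +
   (eta * (j%:R * (U (r + l * K + K)%N - U (r + l * K)%N)) +
    eta * (U (r + l * K + i)%N - U (r + l * K)%N))); last by ring.
apply: le_trans (ler_normD _ _) _; rewrite lerD//.
by apply: le_trans (ler_normD _ _) _; rewrite mulr2n mulrDl mul1r lerD.
Qed.

End Tiling.

Lemma density_ge0 {R : realType} (f : R -> R) (q : R) (U V : nat -> R) n :
  (forall z, 0 <= f z) -> 0 < q -> q < 1 -> 0 <= density f q U V n.
Proof.
move=> f0 q0 q1; have a0 := chain_a_gt0 q0 q1; have b0 := chain_b_gt0 q0 q1.
by rewrite /density /bond_quad !addr_ge0// mulr_ge0 ?sqr_ge0// ltW.
Qed.

Lemma sqrD_le {R : realType} (theta x y : R) : 0 < theta ->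
  (x + y) ^+ 2 <= (1 + theta) * x ^+ 2 + (1 + theta^-1) * y ^+ 2.
Proof.
move=> th0; rewrite -subr_ge0.
rewrite [leRHS](_ : _ = theta^-1 * (theta * x - y) ^+ 2); first by nonneg.
by field; rewrite gt_eqF.
Qed.

(** Pinning changes the increments of V by the gap U - V at the block ends only;
    the weight theta keeps the leading constant close to 1. *)
Lemma pinned_cost {R : realType} (f : R -> R) (q : R) (U V : nat -> R)
    (r K m : nat) (theta : R) :
  (forall z, 0 <= f z) -> 0 < q -> q < 1 -> (0 < K)%N -> 0 < theta ->
  \sum_(n < m * K) density f q U (pinned U V r K) (r + n)%N <=
  (1 + theta) * \sum_(n < m * K) density f q U V (r + n)%N
  + (1 + theta^-1) * 4 * chain_a q *
    \sum_(l < m.+1) (U (r + l * K)%N - V (r + l * K)%N) ^+ 2.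
Proof.
move=> f0 q_gt0 q_lt1 K0 th0.
have a0 := chain_a_gt0 q_gt0 q_lt1; have b0 := chain_b_gt0 q_gt0 q_lt1.
have thV : 0 <= theta^-1 by rewrite invr_ge0 ltW.
pose del n := if (K %| n - r)%N then U n - V n else 0.
have pE n : pinned U V r K n = V n + del n.
  by rewrite /pinned /del; case: ifP => _; ring.
have delsum : \sum_(i < 1 + m * K) del (r + i)%N ^+ 2 =
   \sum_(l < m.+1) (U (r + l * K)%N - V (r + l * K)%N) ^+ 2.
  rewrite [RHS]big_ord_recr [LHS]big_ord_recr /=; congr (_ + _).
    rewrite (sum_blocks m K (fun n => del (r + n)%N ^+ 2)); apply: eq_bigr => l _.
    case: K K0 @del pE => // K _ del _.
    rewrite big_ord_recl addn0 /del addKn dvdn_mull// big1 ?addr0// => i _.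
    rewrite addKn dvdn_addr ?dvdn_mull// gtnNdvd ?expr0n//=.
    by rewrite /bump /= add1n ltnS ltn_ord.
  by rewrite /del addKn dvdn_mull.
rewrite -delsum.
pose X := \sum_(n < m * K) (del (r + n).+1 ^+ 2 + del (r + n)%N ^+ 2).
have XE : X <= 2 * \sum_(i < 1 + m * K) del (r + i)%N ^+ 2.
  rewrite /X big_split /= mulr2n mulrDl mul1r lerD//.
    rewrite [leRHS]big_ord_recl /= addrC; under eq_bigr do rewrite -addnS.
    by rewrite lerDl sqr_ge0.
  by rewrite [leRHS]big_ord_recr /= lerDl sqr_ge0.
apply: (@le_trans _ _ ((1 + theta) * \sum_(n < m * K) density f q U V (r + n)%N
   + (1 + theta^-1) * 2 * chain_a q * X)); last first.
  rewrite lerD2l; apply: (@le_trans _ _ ((1 + theta^-1) * 2 * chain_a q *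
    (2 * \sum_(i < 1 + m * K) del (r + i)%N ^+ 2))).
    by rewrite ler_wpM2l//; nonneg.
  by rewrite le_eqVlt; apply/orP; left; apply/eqP; ring.
rewrite /X !mulr_sumr -big_split /=.
apply: ler_sum => n _; rewrite /density /bond_quad !pE.
set x := V _.+1; set y := V _; set d1 := del _.+1; set d2 := del (r + n)%N.
set u := U _.+1; set ff := f _.
have Hf : 0 <= theta * ff by rewrite mulr_ge0 ?f0// ltW.
have Hb : (u - (x + d1)) ^+ 2 <= (u - x) ^+ 2.
  rewrite /d1 /del /x; case: ifP => _; last by rewrite addr0.
  by rewrite [X in X ^+ 2 <= _](_ : _ = 0) ?expr0n ?sqr_ge0// /u; ring.
have Ha : (x + d1 - (y + d2)) ^+ 2 <=
   (1 + theta) * (x - y) ^+ 2 + (1 + theta^-1) * 2 * (d1 ^+ 2 + d2 ^+ 2).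
  have := sqrD_le (x - y) (d1 - d2) th0.
  have : 0 <= (1 + theta^-1) * (d1 + d2) ^+ 2 by nonneg.
  rewrite (_ : x - y + (d1 - d2) = x + d1 - (y + d2)); last by ring.
  by set t := theta^-1; nra.
have Ha' := ler_wpM2l (ltW a0) Ha; have Hb' := ler_wpM2l (ltW b0) Hb.
have : 0 <= theta * (chain_b q * (u - x) ^+ 2) by nonneg.
by lra.
Qed.

(** The residue classes modulo K partition the terms. *)
Lemma good_offset {R : realType} (g : nat -> R) (m K : nat) : (0 < K)%N ->
  exists2 r, (r < K)%N &
    \sum_(l < m) g (l * K + r)%N <= (\sum_(n < m * K) g n) / K%:R.
Proof.
move=> K0; apply: contrapT => H.
have {}H r : (r < K)%N ->
    (\sum_(n < m * K) g n) / K%:R < \sum_(l < m) g (l * K + r)%N.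
  move=> rK; rewrite ltNge; apply/negP => le; apply: H.
  by exists r.
have : \sum_(r < K) (\sum_(n < m * K) g n) / K%:R <
       \sum_(r < K) \sum_(l < m) g (l * K + r)%N.
  case: K K0 H => // K _ H; rewrite big_ord_recl [ltRHS]big_ord_recl.
  by rewrite ltr_leD ?H//; apply: ler_sum => i _; rewrite ltW// H.
rewrite [ltRHS]exchange_big /= -sum_blocks sumr_const card_ord -[ltLHS]mulr_natr.
by rewrite divfK ?ltxx// pnatr_eq0 -lt0n.
Qed.

(** * Nodes of an interval and the energies in unit scale *)

Section Grid.
Context {R : realType}.
Implicit Types (I : interval R) (eps a b : R) (p : int) (N : nat).

(** The ends of a nondegenerate bounded interval, without distinction between
    open and closed ones. *)
Definition has_ends I a b := [/\ a < b, forall x, x \in I -> a <= x <= b &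
  forall x, a < x < b -> x \in I].

Definition node_range eps I p N :=
  nodes eps I = [set i | exists2 k : nat, (k <= N)%N & i = p + k%:Z].

Lemma intr_addn p n : (p + n%:Z)%:~R = p%:~R + n%:R :> R.
Proof. by rewrite intrD -pmulrn. Qed.

Lemma intr_succ p : (p + 1)%:~R = p%:~R + 1 :> R.
Proof. by rewrite intrD. Qed.

Lemma intr_pred p : (p - 1)%:~R = p%:~R - 1 :> R.
Proof. by rewrite intrD mulrNz. Qed.

Lemma node_range_exists I a b eps : has_ends I a b -> 0 < eps -> 2 * eps < b - a ->
  exists p N, [/\ node_range eps I p N, eps * p%:~R \in I,
    eps * (p%:~R + N%:R) \in I, eps * (p%:~R - 1) <= a &
    b <= eps * (p%:~R + N%:R + 1)].
Proof.
move=> [ab Iab abI] eps0 eab.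
have [p0 p0l p0r] : exists2 p0 : int, eps * (p0%:~R - 1) <= a & a < eps * p0%:~R.
  exists (Num.floor (a / eps) + 1).
    rewrite mulrC -ler_pdivlMr// intrD addrK; exact: floor_le.
  rewrite mulrC -ltr_pdivrMr//; exact: floorD1_gt.
have [q0 q0r q0l] : exists2 q0 : int, b <= eps * (q0%:~R + 1) & eps * q0%:~R < b.
  exists (- (Num.floor ((- b) / eps) + 1)).
    rewrite -lerN2 -mulrN mulrC -ler_pdivlMr// mulrNz intrD opprD opprK addrK.
    exact: floor_le.
  rewrite -ltrN2 -mulrN mulrC -ltr_pdivrMr// mulrNz opprK.
  exact: floorD1_gt.
pose p := if eps * (p0 - 1)%:~R \in I then p0 - 1 else p0.
pose q1 := if eps * (q0 + 1)%:~R \in I then q0 + 1 else q0.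
have p0q0 : p0 <= q0.
  rewrite -ltzD1 -(ltr_int R) intrD -(ltr_pM2l eps0); lra.
have p0q0r : p0%:~R <= q0%:~R :> R by rewrite ler_int.
have pI : eps * p%:~R \in I.
  rewrite /p; case: ifP => // _; apply: abI; rewrite p0r/=.
  by apply: le_lt_trans q0l; rewrite ler_pM2l.
have qI : eps * q1%:~R \in I.
  rewrite /q1; case: ifP => // _; apply: abI; rewrite q0l andbT.
  by apply: (lt_le_trans p0r); rewrite ler_pM2l.
have pp0 : p0 - 1 <= p <= p0 by rewrite /p; case: ifP => _; clear; lia.
have qq0 : q0 <= q1 <= q0 + 1 by rewrite /q1; case: ifP => _; clear; lia.
have nodeP i : eps * i%:~R \in I <-> p <= i <= q1.
  split=> [iI|/andP[pi iq]].
    have /andP[ai ib] := Iab _ iI.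
    have l1 : p0 - 1 <= i.
      rewrite -ltzD1 -(ltr_int R) intr_pred intr_succ -(ltr_pM2l eps0) [ltRHS]mulrDr.
      by apply: le_lt_trans p0l _; lra.
    have l2 : i <= q0 + 1.
      rewrite -ltzD1 -(ltr_int R) !intr_succ -(ltr_pM2l eps0) [ltRHS]mulrDr.
      by apply: le_lt_trans ib _; lra.
    apply/andP; split.
      rewrite /p; case: ifPn => // nI.
      move: l1; rewrite le_eqVlt => /predU1P[E|]; last by clear; lia.
      by move: nI; rewrite E iI.
    rewrite /q1; case: ifPn => // nI.
    move: l2; rewrite le_eqVlt => /predU1P[E|]; last by clear; lia.
    by move: nI; rewrite -E iI.
  have [->//|ip] := eqVneq i p; have [->//|iq1] := eqVneq i q1.
  have [l1 l2] : p0 <= i /\ i <= q0.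
    by move: pi iq ip iq1 pp0 qq0; clear; lia.
  apply: abI; apply/andP; split.
    by apply: (lt_le_trans p0r); rewrite ler_pM2l// ler_int.
  by apply: le_lt_trans q0l; rewrite ler_pM2l// ler_int.
have [N NE] : exists N, q1 = p + N%:Z.
  have pq : 0 <= q1 - p by move: pp0 qq0 p0q0; clear; lia.
  by exists `|q1 - p|%N; rewrite gez0_abs// addrCA subrr addr0.
exists p, N; split=> //.
- apply/seteqP; split=> i /=; rewrite /nodes /=.
    by move=> /nodeP; move: NE; clear => NE pi; exists `|i - p|%N; lia.
  by move=> [k kN ->]; apply/nodeP; move: kN NE; clear; lia.
- by rewrite -intr_addn -NE.
- apply: le_trans p0l; rewrite ler_pM2l// lerD2r ler_int; move: pp0; clear; lia.
- apply: (le_trans q0r); rewrite ler_pM2l// lerD2r -intr_addn -NE ler_int; move: qq0; clear; lia.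
Qed.

Lemma sum_nodes eps I p N (g : int -> R) : node_range eps I p N ->
  \sum_(i \in nodes eps I) g i = \sum_(k < N.+1) g (p + k%:Z).
Proof.
move=> ->.
have inj : injective (fun k : nat => p + k%:Z) by move=> x y /addrI [].
rewrite (_ : [set _ | _] = [set` [seq p + k%:Z | k : nat <- iota 0 N.+1]]); last first.
  apply/seteqP; split=> i.
    move=> [k kN ->]; apply: (map_f (fun k : nat => p + k%:Z)).
    by rewrite mem_iota.
  move=> /mapP[k]; rewrite mem_iota => /andP[_ kN] ->; by exists k.
rewrite -fsbig_seq ?map_inj_uniq ?iota_uniq// big_map.
by rewrite (_ : iota _ _ = index_iota 0 N.+1) ?big_mkord// /index_iota subn0.
Qed.

Lemma sum_bonds eps I p N (g : int -> R) : node_range eps I p N ->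
  \sum_(i \in bonds eps I) g i = \sum_(k < N) g (p + k.+1%:Z).
Proof.
move=> rng.
have inj : injective (fun k : nat => p + k.+1%:Z) by move=> x y /addrI [].
rewrite (_ : bonds _ _ = [set` [seq p + k.+1%:Z | k : nat <- iota 0 N]]); last first.
  rewrite /bonds rng; apply/seteqP; split=> i.
    move=> [[k kN iE] [k' k'N iE']].
    rewrite (_ : i = p + k'.+1%:Z); last by move: iE'; clear; lia.
    apply: (map_f (fun k : nat => p + k.+1%:Z)); rewrite mem_iota.
    by move: iE iE' kN; clear; lia.
  move=> /mapP[k]; rewrite mem_iota => /andP[_ kN] ->; split.
    by exists k.+1.
  by exists k; [exact: ltnW | clear; lia].
rewrite -fsbig_seq ?map_inj_uniq ?iota_uniq// big_map.
by rewrite (_ : iota _ _ = index_iota 0 N) ?big_mkord// /index_iota subn0.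
Qed.

End Grid.

Section RangeEnergies.
Context {R : realType} (f : R -> R) (sigma eps : R) (I : interval R).
Context (p : int) (N : nat) (eps_gt0 : 0 < eps) (rng : node_range eps I p N).
Let q := expR (- sigma).
Let scaled (u : int -> R) (n : nat) : R := u (p + n%:Z) / eps.

Lemma local_energyE u : local_energy f eps I u =
  eps * \sum_(n < N) f (scaled u n.+1 - scaled u n).
Proof.
rewrite /local_energy (sum_bonds _ rng); congr (_ * _); apply: eq_bigr => n _.
by rewrite /scaled -mulrBl (_ : p + n.+1%:Z - 1 = p + n%:Z)//; lia.
Qed.

Lemma two_field_energyE u v : two_field_energy f sigma eps I u v =
  eps * \sum_(n < N) density f q (scaled u) (scaled v) n.
Proof.
have e0 : eps != 0 by rewrite gt_eqF.
rewrite /two_field_energy local_energyE !(sum_bonds _ rng) /density big_split /=.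
rewrite mulrDr -addrA; congr (_ + _).
rewrite /bond_quad big_split /= -!mulr_sumr mulrDr; congr (_ + _).
  rewrite /a_coef -/q -/(chain_a q) mulrCA -[LHS]mulrA; congr (_ * _).
  rewrite !mulr_sumr; apply: eq_bigr => n _.
  rewrite /scaled -mulrBl (_ : p + n.+1%:Z - 1 = p + n%:Z); last by lia.
  by field.
rewrite /b_coef -/q -/(chain_b q) mulrCA -[LHS]mulrA; congr (_ * _).
rewrite !mulr_sumr; apply: eq_bigr => n _.
by rewrite /scaled -mulrBl; field.
Qed.

Lemma nonlocal_energyE u : nonlocal_energy f sigma eps I u =
  eps * (\sum_(n < N) f (scaled u n.+1 - scaled u n) + pair_sum q (scaled u) N).
Proof.
rewrite /nonlocal_energy local_energyE mulrDr (sum_nodes _ rng).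
congr (_ + _ * _); rewrite /pair_sum; apply: eq_bigr => n _.
rewrite (sum_nodes _ rng); apply: eq_bigr => m _.
rewrite /scaled -mulrBl; congr (_ * _).
rewrite /q -expRM_natl; congr expR.
rewrite mulrN mulrC; congr (- (_ * _)).
rewrite -abszE pmulrn -pmulrn; congr (_%:R); lia.
Qed.

End RangeEnergies.

(** * Transplanting a profile to a finer grid *)

Section Clamp.
Context {R : realType} (f : R -> R) (q : R).

(** The tile occupies the nodes A, ..., A + T and is prolonged by constants. *)
Definition clamp (A T j : nat) : nat := minn T (j - A).

Lemma density_shift (c : R) (W Z : nat -> R) n :
  density f q (fun j => c + W j) (fun j => c + Z j) n = density f q W Z n.
Proof.
rewrite /density /bond_quad; congr (f _ + (_ * _ ^+ 2 + _ * _ ^+ 2)); ring.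
Qed.

Lemma density_clamp_sum (W Z : nat -> R) (A T B : nat) :
  Z 0%N = W 0%N -> Z T = W T ->
  \sum_(j < A + (T + B)) density f q (W \o clamp A T) (Z \o clamp A T) j =
  f 0 *+ A + \sum_(t < T) density f q W Z t + f 0 *+ B.
Proof.
move=> Z0 ZT.
rewrite big_split_ord big_split_ord /= addrA; congr (_ + _ + _).
- rewrite (eq_bigr (fun=> f 0)) ?sumr_const ?card_ord// => -[j jA] _ /=.
  rewrite /density /bond_quad /= /clamp.
  have -> : minn T (j.+1 - A) = 0%N by move: jA; clear; lia.
  have -> : minn T (j - A) = 0%N by move: jA; clear; lia.
  by rewrite Z0 !subrr expr0n !mulr0 !addr0.
- apply: eq_bigr => -[t tT] _ /=; rewrite /density /bond_quad /= /clamp.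
  have -> : minn T ((A + t).+1 - A) = t.+1 by move: tT; clear; lia.
  by have -> : minn T (A + t - A) = t by move: tT; clear; lia.
- rewrite (eq_bigr (fun=> f 0)) ?sumr_const ?card_ord// => -[j jA] _ /=.
  rewrite /density /bond_quad /= /clamp.
  have -> : minn T ((A + (T + j)).+1 - A) = T by clear; lia.
  have -> : minn T (A + (T + j) - A) = T by clear; lia.
  by rewrite ZT !subrr expr0n !mulr0 !addr0.
Qed.

Lemma sub_sum_le (g : nat -> R) (r n N : nat) : (forall i, 0 <= g i) ->
  (r + n <= N)%N -> \sum_(i < n) g (r + i)%N <= \sum_(i < N) g i.
Proof.
move=> g0 rnN; rewrite -(subnK rnN) addnC -addnA big_split_ord /= addrC.
rewrite big_split_ord /= -addrA lerDl addr_ge0 ?sumr_ge0//.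
Qed.

Lemma ler_sum_term (g : nat -> R) (n N : nat) : (forall i, 0 <= g i) ->
  (n <= N)%N -> g n <= \sum_(i < N.+1) g i.
Proof.
move=> g0 nN; rewrite (bigD1 (inord n)) //= inordK// lerDl; exact: sumr_ge0.
Qed.

End Clamp.

Section TileLocation.
Context {R : realType} (eps eta x X Y : R) (k K r m H A N j t : nat).
Hypotheses (eta_gt0 : 0 < eta) (k_gt0 : (0 < k)%N) (K_gt0 : (0 < K)%N).
Hypotheses (copies_le : eta * k%:R <= eps) (copies_ge : eps <= eta * k%:R + eta).
Hypotheses (eta_small : eta * (N%:R + 2) <= eps).
Hypotheses (rK : (r <= K)%N) (rmN : (r + m * K <= N)%N) (Nrm : (N <= r + m * K + 2 * K)%N).
Hypotheses (start_le : eta * (Y + A%:R) <= eps * (X + r%:R)).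
Hypotheses (start_ge : eps * (X + r%:R) < eta * (Y + A%:R) + eta).
Hypotheses (xj : `|x - eta * (Y + j%:R)| <= eta).
Hypotheses (tN : (t <= N)%N) (xt : `|x - eps * (X + t%:R)| <= (H%:R + 2) * eps).

Let T := (m * (k * K))%N.
Let l := (clamp A T j %/ (k * K))%N.

(** Node j of the fine grid at distance at most eta from x reads a copy of block
    l; if x is also close to node t of the coarse grid, then t is within a
    multiple of K of the start r + l K of that block.  The drift between the
    two grids is at most one eta per coarse node, in total less than eps. *)
Lemma tile_location : [/\ (l <= m)%N, (t <= r + l * K + (2 * K + H + 4))%N &
  (r + l * K <= t + (2 * K + H + 4))%N].
Proof.
have kK0 : (0 < k * K)%N by rewrite muln_gt0 k_gt0.
have eps0 : 0 < eps by apply: lt_le_trans copies_le; rewrite mulr_gt0// ltr0n.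
have lT : (clamp A T j <= T)%N by exact: geq_minl.
have lm : (l <= m)%N by rewrite -(mulnK m kK0) leq_div2r.
move: xj xt; rewrite !ler_distl => /andP[xj1 xj2] /andP[xt1 xt2].
have mK_N : l%:R * K%:R <= N%:R :> R.
  rewrite -natrM ler_nat; apply: leq_trans rmN; apply: leq_trans (leq_addl _ _).
  by rewrite leq_mul2r lm orbT.
split=> //.
  have [jAT|] := ltnP j (A + T)%N; last first.
    move=> ATj; have -> : l = m.
      rewrite /l (_ : clamp A T j = T) ?mulnK//.
      by move: ATj; rewrite /clamp; clear; lia.
    by move: tN Nrm; clear; lia.
  have jle : (j <= A + clamp A T j)%N by move: jAT; rewrite /clamp; clear; lia.
  have tlt : (clamp A T j < l.+1 * (k * K))%N by rewrite ltn_ceil.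
  have jle' : (j <= A + l.+1 * (k * K))%N.
    by apply: leq_trans jle _; rewrite leq_add2l ltnW.
  have jr : eta * j%:R <= eta * A%:R + l.+1%:R * K%:R * eps.
    apply: (@le_trans _ _ (eta * (A + l.+1 * (k * K))%:R)).
      by rewrite ler_pM2l// ler_nat.
    rewrite natrD mulrDr lerD2l !natrM [leLHS](_ : _ = l.+1%:R * K%:R * (eta * k%:R)).
      by rewrite ler_wpM2l// mulr_ge0.
    by ring.
  rewrite -(ler_nat R) -(ler_pM2l eps0) !natrD !natrM.
  have K0' : 0 <= eps * K%:R by rewrite mulr_ge0// ltW.
  have N0' : 0 <= eta * N%:R by rewrite mulr_ge0// ltW.
  have l1 : l.+1%:R * K%:R * eps = l%:R * K%:R * eps + eps * K%:R.
    by rewrite -natr1; ring.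
  by move: start_le xj1 xj2 xt1 xt2 eta_small jr; rewrite l1 !mulrDr; lra.
have [jA|Aj] := ltnP j A.
  have -> : l = 0%N.
    by rewrite /l (_ : clamp A T j = 0%N) ?div0n// /clamp; move: jA; clear; lia.
  by move: rK; clear; lia.
have tle : (l * (k * K) <= clamp A T j)%N by exact: leq_trunc_div.
have jge : (A + l * (k * K) <= j)%N.
  by move: tle Aj; rewrite /clamp; clear; lia.
have jr : eta * A%:R + l%:R * K%:R * (eps - eta) <= eta * j%:R.
  apply: (@le_trans _ _ (eta * (A + l * (k * K))%:R)); last first.
    by rewrite ler_pM2l// ler_nat.
  rewrite natrD [leRHS]mulrDr lerD2l !natrM [leRHS](_ : _ = l%:R * K%:R * (eta * k%:R)).
    by rewrite ler_wpM2l ?mulr_ge0// lerBlDr.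
  by ring.
have lN : l%:R * K%:R * eta <= eta * N%:R by rewrite mulrC ler_pM2l.
rewrite -(ler_nat R) -(ler_pM2l eps0) !natrD !natrM.
have K0' : 0 <= eps * K%:R by rewrite mulr_ge0// ltW.
by move: start_ge xj1 xj2 xt1 xt2 eta_small jr lN; rewrite !mulrDr; lra.
Qed.

End TileLocation.

Lemma ler_dist_sum {R : realType} (U : nat -> R) (n n' N : nat) :
  (n <= N)%N -> (n' <= N)%N -> `|U n - U n'| <= 2 * \sum_(i < N.+1) `|U i|.
Proof.
move=> nN n'N; apply: le_trans (ler_normB _ _) _.
rewrite mulr2n mulrDl mul1r lerD//.
  exact: (ler_sum_term (fun=> normr_ge0 _) nN).
exact: (ler_sum_term (fun=> normr_ge0 _) n'N).
Qed.

Section TileTheorem.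
Context {R : realType} (f : R -> R) (c sigma : R) (I : interval R) (a b : R).
Hypotheses (f_ge0 : forall z, 0 <= f z) (f0c : f 0 <= c) (sigma_gt0 : 0 < sigma).
Hypothesis Iab : has_ends I a b.
Let q := expR (- sigma).

Let q_gt0 : 0 < q. Proof. exact: expR_gt0. Qed.
Let q_lt1 : q < 1. Proof. by rewrite -expR0 ltr_expR oppr_lt0. Qed.

(** From one profile (U, V) at scale eps, fields at every small scale eta whose
    energies, for both functionals, are almost that of (U, V), and which stay
    uniformly close to it.  The integer H measures how far the profile is from
    the ends of the interval; on that part, and on the incomplete blocks, the
    fields are constant and only f 0 <= c is paid. *)
Lemma tiling (eps : R) (p : int) (N H K : nat) (U V : nat -> R) (theta w : R) :
  0 < eps -> eps * p%:~R \in I -> eps * (p%:~R + N%:R) \in I ->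
  eps * (p%:~R - H%:R) <= a -> b <= eps * (p%:~R + N%:R + H%:R) ->
  (0 < K < N)%N -> 0 < theta ->
  (forall n n', (n' <= n <= N)%N -> (n <= n' + (2 * K + H + 4))%N ->
     eps * `|U n - U n'| <= w) ->
  let D := eps * \sum_(n < N) density f q U V n in
  let bound := (1 + theta) * D
    + (1 + theta^-1) * 4 * (chain_a q / chain_b q) * D / K%:R
    + c * (eps * (3 * K%:R + 2 * H%:R)) in
  forall delta, 0 < delta -> exists2 tau, 0 < tau &
  forall eta, 0 < eta -> eta < tau -> exists u v : int -> R,
  [/\ two_field_energy f sigma eta I u v <= bound + delta,
      nonlocal_energy f sigma eta I u <= bound + delta,
      forall i, `|v i - u i| <= delta &
      forall x i t, x \in I -> nodes eta I i -> `|x - eta * i%:~R| <= eta ->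
        (t <= N)%N -> `|x - eps * (p%:~R + t%:R)| <= (H%:R + 2) * eps ->
        `|u i - eps * U t| <= 3 * w + delta].
Proof.
move=> eps0 pI NI aH bH /andP[K0 KN] th0 osc D bound delta d0.
have [ab Ile abI] := Iab.
have /andP[a_p _] := Ile _ pI; have /andP[_ N_b] := Ile _ NI.
have cge0 : 0 <= c := le_trans (f_ge0 0) f0c.
have a0 := chain_a_gt0 q_gt0 q_lt1; have b0 := chain_b_gt0 q_gt0 q_lt1.
have w0 : 0 <= w.
  by apply: le_trans (osc 0%N 0%N _ _); rewrite ?mulr_ge0 ?(ltW eps0).
(* m blocks and an offset r <= K fit into N - 1 bonds. *)
have [m mE] : exists m, (N.-1 %/ K)%N = m.+1.
  by exists (N.-1 %/ K).-1; rewrite prednK// divn_gt0//; move: KN; clear; lia.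
have mK : (m * K + K < N)%N.
  have : (m * K + K <= N.-1)%N by rewrite -mulSnr -mE leq_trunc_div.
  by move: KN; clear; lia.
have Nm : (N <= m * K + 2 * K)%N.
  have : (N.-1 < m * K + K + K)%N by rewrite -!mulSnr -mE ltn_ceil.
  by clear; lia.
have [r0 r0K good] := good_offset (fun n => (U n.+1 - V n.+1) ^+ 2) m.+1 K0.
pose r := r0.+1.
have rm : (r + m * K < N)%N by move: r0K mK; rewrite /r; clear; lia.
have rm' := ltnW rm.
pose C1 := 2 * \sum_(n < N.+1) `|U n|.
pose C2 := \sum_(n < N.+1) (`|U n| + `|V n|).
have C1ge0 : 0 <= C1 by rewrite mulr_ge0// sumr_ge0.
have C2ge0 : 0 <= C2 by rewrite sumr_ge0// => *; rewrite addr_ge0.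
exists (Num.min (Num.min (delta / (C1 + 1)) (delta / (C2 + 1)))
       (Num.min (Num.min (eps / (N%:R + 2)) (delta / (c * N%:R + 1))) ((b - a) / 2))).
  rewrite !lt_min !divr_gt0 ?subr_gt0// ?ltr_wpDl// ?mulr_ge0//.
move=> eta eta0; rewrite !lt_min => /andP[/andP[]].
rewrite ltr_pdivlMr ?ltr_wpDl// => eC1; rewrite ltr_pdivlMr ?ltr_wpDl// => eC2.
move=> /andP[/andP[]]; rewrite ltr_pdivlMr ?ltr_wpDl// => eN.
rewrite ltr_pdivlMr ?ltr_wpDl ?mulr_ge0// => ecN.
rewrite ltr_pdivlMr// => eab.
have [p' [N' [rng p'I N'I p'a N'b]]] := node_range_exists Iab eta0 ltac:(lra).
pose k := Num.truncn (eps / eta).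
have etak : eta * k%:R <= eps.
  by rewrite mulrC -ler_pdivlMr// truncn_le// divr_ge0// ltW.
have epsk : eps <= eta * k%:R + eta.
  rewrite -[X in _ + X]mulr1 -mulrDr natr1 mulrC -ler_pdivrMr//.
  by rewrite ltW// truncnS_gt.
have N0r : 0 <= N%:R :> R by [].
have etaN : 0 <= eta * N%:R by rewrite mulr_ge0// ltW.
have k0 : (0 < k)%N.
  rewrite -(ltr_nat R) -(ltr_pM2l eta0) mulr0; move: epsk eN; rewrite mulrDr; lra.
pose T := (m * (k * K))%N.
(* The tile starts at the last fine node before eps * (p + r). *)
pose s0 := Num.floor (eps * (p%:~R + r%:R) / eta).
have s0l : eta * s0%:~R <= eps * (p%:~R + r%:R).
  rewrite mulrC -ler_pdivlMr//; exact: floor_le.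
have s0r : eps * (p%:~R + r%:R) < eta * s0%:~R + eta.
  rewrite -[X in _ < _ + X]mulr1 -mulrDr [ltRHS]mulrC -ltr_pdivrMr// -intr_succ.
  exact: floorD1_gt.
have pr : eps * p%:~R + eps <= eps * (p%:~R + r%:R).
  by rewrite -[X in _ + X]mulr1 -mulrDr ler_pM2l// lerD2l ler1n.
have e2 : eta * 2 <= eps by move: eN etaN; rewrite mulrDr; lra.
have p's0 : p' <= s0.
  rewrite -ltzD1 -(ltr_int R) intr_succ -ltrBlDr -(ltr_pM2l eta0).
  by apply: le_lt_trans p'a _; lra.
have [A s0E] : exists A, s0 = p' + A%:Z.
  exists `|s0 - p'|%N; rewrite gez0_abs ?subr_ge0//.
  by rewrite addrCA subrr addr0.
have TE : eta * T%:R = m%:R * K%:R * (eta * k%:R) by rewrite /T !natrM; ring.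
have mKr : (r%:R + m%:R * K%:R + 1 <= N%:R :> R).
  by rewrite -natrM -natrD natr1 ler_nat.
have T_le : eta * T%:R <= m%:R * K%:R * eps by rewrite TE ler_wpM2l// mulr_ge0.
have T_ge : m%:R * K%:R * (eps - eta) <= eta * T%:R.
  by rewrite TE ler_wpM2l ?mulr_ge0// lerBlDr.
(* The tile fits into the fine grid because the blocks end before node N. *)
have s0T : (A + T <= N')%N.
  rewrite -ltnS -(ltr_nat R) -natr1 natrD -(ltrD2l p'%:~R) [ltLHS]addrA.
  rewrite [ltRHS]addrA -(ltr_pM2l eta0).
  apply: lt_le_trans N'b; apply: lt_le_trans N_b.
  move: s0l; rewrite s0E intr_addn mulrDr => s0l.
  have := ler_wpM2l (ltW eps0) mKr; lra.
have [B N'E] : exists B, N' = (A + (T + B))%N.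
  by exists (N' - (A + T))%N; move: s0T; clear; lia.
pose W := tile U r k K; pose Z := tile_aux U V r k K.
have Z0 : Z 0%N = W 0%N by rewrite /Z tile_aux_node.
have KT : (K %| T)%N by rewrite /T mulnA dvdn_mull.
have ZT : Z T = W T by rewrite /Z tile_aux_node.
pose at_ (X : nat -> R) (i : int) : R := eps * U r + eta * X (clamp A T `|i - p'|%N).
have at_E X : (fun n : nat => at_ X (p' + n%:Z) / eta) =
    (fun n => eps * U r / eta + (X \o clamp A T) n).
  apply/funext => n; rewrite /at_ /= (_ : absz (p' + n%:Z - p')%R = n).
    by field; rewrite gt_eqF.
  by clear; lia.
have e0' := ltW eta0.
have energy : two_field_energy f sigma eta I (at_ W) (at_ Z) <= bound + delta.
  rewrite (two_field_energyE _ _ eta0 rng) !at_E.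
  under eq_bigr do rewrite density_shift.
  rewrite N'E density_clamp_sum//.
  rewrite (eq_bigr (fun t : 'I_T => density f q U (pinned U V r K) (source r k K t)));
    last first.
    by move=> t _; rewrite density_tile.
  rewrite (sum_source _ K0 k0 (density f q U (pinned U V r K))).
  pose Dn := \sum_(n < N) density f q U V n; have DE : D = eps * Dn by [].
  have Dn0 : 0 <= Dn by apply: sumr_ge0 => n _; exact: density_ge0.
  have Kr0 : 0 < K%:R :> R by rewrite ltr0n.
  have gap : \sum_(l < m.+1) (U (r + l * K)%N - V (r + l * K)%N) ^+ 2 <=
      Dn / chain_b q / K%:R.
    under eq_bigr do rewrite /r addSn addnC.
    apply: le_trans good _; rewrite ler_wpM2r ?invr_ge0//.
    rewrite ler_pdivlMr//.
    apply: (@le_trans _ _ (\sum_(n < m.+1 * K) density f q U V n)).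
      rewrite mulr_suml; apply: ler_sum => n _.
      rewrite /density /bond_quad mulrC addrA lerDr addr_ge0// mulr_ge0 ?sqr_ge0//.
      exact: ltW.
    apply: (sub_sum_le (r := 0)) => [n|]; first exact: density_ge0.
    by rewrite add0n mulSnr ltnW.
  have inner : \sum_(n < m * K) density f q U (pinned U V r K) (r + n)%N <=
      (1 + theta) * Dn + (1 + theta^-1) * 4 * chain_a q * (Dn / chain_b q / K%:R).
    apply: le_trans (pinned_cost _ _ _ _ f_ge0 q_gt0 q_lt1 K0 th0) _.
    have thV : 0 <= theta^-1 by rewrite invr_ge0 ltW.
    rewrite lerD//.
      rewrite ler_wpM2l// ?addr_ge0// ?(ltW th0)//.
      by apply: sub_sum_le => // n; exact: density_ge0.
    by rewrite ler_wpM2l//; nonneg.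
  have innerk : eta * k%:R * \sum_(n < m * K) density f q U (pinned U V r K) (r + n)%N <=
     (1 + theta) * D + (1 + theta^-1) * 4 * (chain_a q / chain_b q) * D / K%:R.
    apply: (le_trans (ler_wpM2l _ inner)); first by rewrite mulr_ge0.
    rewrite [leRHS](_ : _ = eps * ((1 + theta) * Dn +
        (1 + theta^-1) * 4 * chain_a q * (Dn / chain_b q / K%:R))); last first.
      by rewrite DE; field; rewrite !gt_eqF.
    rewrite ler_wpM2r//.
    have thV : 0 <= theta^-1 by rewrite invr_ge0 ltW.
    by nonneg.
  have outer : eta * (f 0 *+ A + f 0 *+ B) <= c * (eps * (3 * K%:R + 2 * H%:R)) + delta.
    rewrite -mulrnDr -mulr_natr mulrCA.
    have AB : eta * (A + B)%:R <= eps * (3 * K%:R + 2 * H%:R) + eta * N%:R.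
      have ABN : (A + B)%:R = N'%:R - T%:R :> R by rewrite N'E !natrD; ring.
      have /andP[ap' _] := Ile _ p'I; have /andP[_ N'b'] := Ile _ N'I.
      have Nmr : (N%:R <= m%:R * K%:R + 2 * K%:R :> R).
        by rewrite -!natrM -natrD ler_nat.
      have Nmr' := ler_wpM2l (ltW eps0) Nmr.
      have mKN : m%:R * K%:R * eta <= eta * N%:R.
        rewrite mulrC ler_pM2l// -natrM ler_nat.
        by move: rm'; clear; lia.
      have K0' : 0 <= eps * K%:R by rewrite mulr_ge0// ltW.
      rewrite ABN; move: aH bH ap' N'b' Nmr' T_ge mKN.
      by rewrite !mulrDr; lra.
    have c1 : f 0 * (eta * (A + B)%:R) <= c * (eta * (A + B)%:R).
      by rewrite ler_wpM2r// mulr_ge0.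
    have c2 := ler_wpM2l cge0 AB.
    by move: c1 c2 ecN; rewrite !mulrDr; lra.
  move: innerk outer; rewrite /bound !mulrDr; lra.
exists (at_ W), (at_ Z); split=> //.
- apply: le_trans energy.
  rewrite (two_field_energyE _ _ eta0 rng) (nonlocal_energyE _ _ eta0 rng) !at_E.
  rewrite ler_pM2l// /density [leRHS]big_split; apply: lerD.
    by apply: ler_sum => n _; rewrite !(congr1 (@^~ _) (at_E W)).
  apply: pair_sum_le_two_field => //; rewrite /= /clamp.
    by rewrite sub0n minn0 Z0.
  rewrite (_ : minn T (N' - A) = T) ?ZT//.
  by move: N'E; clear; lia.
- move=> i; rewrite /at_ opprD addrACA subrr add0r -mulrBr normrM gtr0_norm//.
  set t := clamp A T _.
  have tT : (t <= T)%N by exact: geq_minl.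
  apply: (@le_trans _ _ (eta * C2)); last by lra.
  rewrite ler_wpM2l// /Z /tile_aux -/W addrC addKr /pinned.
  case: ifPn => [_|Kt]; first by rewrite subrr normr0.
  have sN : (source r k K t <= N)%N.
    have tlT : (t < T)%N.
      rewrite ltn_neqAle tT andbT; apply: contraNneq Kt => ->.
      exact: source_node.
    have lm : (t %/ (k * K) < m)%N by rewrite ltn_divLR// muln_gt0 k0.
    apply: leq_trans rm'; rewrite /source -addnA leq_add2l.
    apply: (@leq_trans ((t %/ (k * K)).+1 * K)); last by rewrite leq_mul2r lm orbT.
    by rewrite mulSnr leq_add2l ltnW// ltn_mod.
  apply: le_trans (ler_normB _ _) _; rewrite addrC /C2.
  exact: (ler_sum_term (g := fun n => `|U n| + `|V n|)
    (fun=> addr_ge0 (normr_ge0 _) (normr_ge0 _)) sN).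
- move=> x i t xI; rewrite rng => -[j jN' ->] xj tN xt.
  rewrite /at_ (_ : absz (p' + j%:Z - p')%R = j); last by clear; lia.
  rewrite intr_addn in xj.
  have st1 : eta * (p'%:~R + A%:R) <= eps * (p%:~R + r%:R).
    by rewrite -(intr_addn p' A) -s0E.
  have st2 : eps * (p%:~R + r%:R) < eta * (p'%:~R + A%:R) + eta.
    by rewrite -(intr_addn p' A) -s0E.
  have Nrm : (N <= r + m * K + 2 * K)%N by move: Nm; clear; lia.
  have [lm l1 l2] := tile_location eta0 k0 K0 etak epsk (ltW eN) r0K rm' Nrm
    st1 st2 xj tN xt.
  set l := (_ %/ _)%N in lm l1 l2.
  have rlN : (r + l * K <= N)%N.
    apply: leq_trans rm'; rewrite leq_add2l leq_mul2r lm orbT //.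
  have oscK n n' : (n <= r + m * K)%N -> (n' <= n)%N -> (n <= n' + K)%N ->
      eps * `|U n - U n'| <= w.
    move=> h1 h2 h3; apply: osc; first by rewrite h2 (leq_trans h1).
    by move: h3; clear; lia.
  have near1 := tile_near K0 k0 e0' etak epsk oscK (geq_minl T (j - A)).
  have near2 : `|eps * U (r + l * K)%N - eps * U t| <= w.
    rewrite -mulrBr normrM gtr0_norm//.
    have [tr|rt] := leqP t (r + l * K)%N.
      by apply: osc; rewrite ?tr.
    by rewrite distrC; apply: osc; rewrite // (ltnW rt).
  have near3 : eta * `|U (r + l * K)%N - U r| <= delta.
    apply: (@le_trans _ _ (eta * C1)); last by lra.
    rewrite ler_wpM2l//; apply: ler_dist_sum => //.
    by apply: leq_trans rm'; exact: leq_addr.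
  rewrite -/W in near1; rewrite (_ : _ - _ =
    (eta * W (clamp A T j) + eps * U r - eps * U (r + l * K)%N) +
    (eps * U (r + l * K)%N - eps * U t)); last by ring.
  apply: le_trans (ler_normD _ _) _; move: near1; rewrite -/l; lra.
Qed.

End TileTheorem.

(** * Oscillation bounds and boundary layers *)

Section Oscillation.
Context {R : realType}.
Implicit Types (U g : nat -> R).

Lemma sqr_sum_le (m : nat) g :
  (\sum_(i < m) g i) ^+ 2 <= m%:R * \sum_(i < m) g i ^+ 2.
Proof.
elim: m => [|m ih]; first by rewrite !big_ord0 mulr0 expr0n.
case: m ih => [_|m ih]; first by rewrite !big_ord1 mul1r.
rewrite big_ord_recr [in leRHS]big_ord_recr /=.
set s := \sum_(i < m.+1) g i in ih *; set S := \sum_(i < m.+1) g i ^+ 2 in ih *.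
have m0 : 0 < m.+1%:R :> R by rewrite ltr0n.
have := sqrD_le s (g m.+1) (ltac:(by rewrite invr_gt0) : 0 < m.+1%:R^-1 :> R).
move=> /le_trans; apply; rewrite invrK.
have h1 : (1 + m.+1%:R^-1) * s ^+ 2 <= (1 + m.+1%:R^-1) * (m.+1%:R * S).
  by rewrite ler_wpM2l// addr_ge0// invr_ge0.
rewrite [leRHS](_ : _ = (1 + m.+1%:R^-1) * (m.+1%:R * S) + (1 + m.+1%:R) * g m.+1 ^+ 2).
  by rewrite lerD2r.
by rewrite -[m.+2%:R]natr1; field; rewrite gt_eqF.
Qed.

Lemma sqr_increment_le U (n n' N : nat) : (n' <= n <= N)%N ->
  (U n - U n') ^+ 2 <= (n - n')%:R * \sum_(i < N) (U i.+1 - U i) ^+ 2.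
Proof.
move=> /andP[n'n nN].
have -> : U n - U n' = \sum_(i < n - n') (U (n' + i).+1 - U (n' + i)%N).
  by rewrite telescope_sum subnKC.
apply: le_trans (sqr_sum_le _ (fun i => U (n' + i).+1 - U (n' + i)%N)) _; rewrite ler_wpM2l//.
apply: (sub_sum_le (g := fun i => (U i.+1 - U i) ^+ 2)) => [i|]; first exact: sqr_ge0.
by rewrite subnKC.
Qed.

(** A discrete Dirichlet bound is a Hoelder bound of exponent 1/2. *)
Lemma oscillation_le U (N L : nat) (eps S w : R) : 0 < eps -> 0 <= w ->
  eps * \sum_(i < N) (U i.+1 - U i) ^+ 2 <= S -> eps * (L%:R * S) <= w ^+ 2 ->
  forall n n', (n' <= n <= N)%N -> (n <= n' + L)%N -> eps * `|U n - U n'| <= w.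
Proof.
move=> eps0 w0 US Lw n n' nn' nL.
rewrite -[leLHS]ger0_norm; last by rewrite mulr_ge0// ltW.
rewrite -ler_sqr ?nnegrE// normrM normr_id -normrM real_normK ?num_real// exprMn.
apply: (le_trans _ Lw); rewrite expr2 -mulrA ler_pM2l//.
apply: (@le_trans _ _ (eps * (L%:R * \sum_(i < N) (U i.+1 - U i) ^+ 2))).
  rewrite ler_pM2l//; apply: le_trans (sqr_increment_le _ nn') _.
  rewrite ler_wpM2r ?ler_nat ?leq_subLR// sumr_ge0// => i _; exact: sqr_ge0.
by rewrite mulrCA ler_wpM2l.
Qed.

End Oscillation.

Section Cut.
Context {R : realType} (q : R) (q_gt0 : 0 < q) (q_lt1 : q < 1).
Implicit Types (U : nat -> R).

Let term_ge0 U (i j : nat) (m : nat) : 0 <= q ^+ m * (U i - U j) ^+ 2.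
Proof. by rewrite mulr_ge0 ?sqr_ge0// exprn_ge0// ltW. Qed.

Lemma end_sum_ge0 U N m : 0 <= end_sum q U N m.
Proof. by apply: sumr_ge0 => i _. Qed.

Lemma pair_sumE U N : pair_sum q U N = \sum_(m < N.+1) end_sum q U N m.
Proof. by rewrite /pair_sum exchange_big. Qed.

Lemma pair_sum_ge0 U N : 0 <= pair_sum q U N.
Proof. by rewrite pair_sumE sumr_ge0// => i _; exact: end_sum_ge0. Qed.

Lemma increments_le_pair_sum U N :
  2 * q * \sum_(i < N) (U i.+1 - U i) ^+ 2 <= pair_sum q U N.
Proof.
rewrite pair_sum_steps mulr_sumr; apply: ler_sum => i _.
rewrite ler_wpM2l ?mulr_ge0 ?(ltW q_gt0)// /past_sum big_ord_recr /= subnn expr0 mul1r.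
by rewrite lerDr sumr_ge0.
Qed.

Lemma end_sum_shift U (c n N m : nat) : (c + n <= N)%N -> (m <= n)%N ->
  end_sum q (fun t => U (c + t)%N) n m <= end_sum q U N (c + m).
Proof.
move=> cnN mn; rewrite /end_sum.
pose g j := q ^+ absz (j%:Z - (c + m)%:Z) * (U j - U (c + m)%N) ^+ 2.
have := @sub_sum_le _ g c n.+1 N.+1 (fun=> term_ge0 _ _ _ _).
rewrite addnS ltnS cnN => /(_ isT); apply: le_trans.
rewrite le_eqVlt; apply/orP; left; apply/eqP; apply: eq_bigr => j _.
by rewrite /g; congr (q ^+ absz _ * _); lia.
Qed.

Lemma pair_sum_shift U (c n N : nat) : (c + n <= N)%N ->
  pair_sum q (fun t => U (c + t)%N) n <= pair_sum q U N.
Proof.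
move=> cnN; rewrite !pair_sumE.
apply: (@le_trans _ _ (\sum_(m < n.+1) end_sum q U N (c + m))).
  by apply: ler_sum => m _; apply: end_sum_shift => //; rewrite -ltnS.
apply: (sub_sum_le (g := end_sum q U N)) => [m|]; first exact: end_sum_ge0.
by rewrite addnS ltnS.
Qed.

(** The interactions of the K first nodes with the whole profile add up to at
    most the nonlocal energy, so that one of them is below its K-th part; the
    same holds for the last K nodes.  Cutting the profile there makes the
    boundary layer of [two_field_le_pair_sum] negligible. *)
Lemma cut_ends : exists2 C : R, 0 < C & forall U (N K : nat), (0 < K)%N -> (2 * K <= N)%N ->
  exists n0 n1 Z, [/\ (n0 < K)%N, (n0 <= n1)%N, (n1 <= N < n1 + K)%N &
   \sum_(t < n1 - n0) bond_quad q (fun t => U (n0 + t)%N) Z t <=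
   (1 + C / K%:R) * pair_sum q U N].
Proof.
have [C C0 HC] := two_field_le_pair_sum q_gt0 q_lt1.
exists (2 * C); first by rewrite mulr_gt0.
move=> U N K K0 KN.
have [n0 n0K e0] := good_offset (end_sum q U N) 1 K0.
have [n1' n1K e1] := good_offset (fun m => end_sum q U N (N - m)) 1 K0.
rewrite !big_ord1 !mul1n in e0 e1.
set n1 := (N - n1')%N in e1.
have n0n1 : (n0 <= n1)%N by rewrite /n1; move: KN n0K n1K; clear; lia.
have n1N : (n1 <= N)%N by exact: leq_subr.
have [Z HZ] := HC (fun t => U (n0 + t)%N) (n1 - n0)%N.
exists n0, n1, Z; split=> //.
  by rewrite n1N /n1; move: KN n1K; clear; lia.
apply: (le_trans HZ).
have s1 := @pair_sum_shift U n0 (n1 - n0) N ltac:(by rewrite subnKC).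
have s2 := @end_sum_shift U n0 (n1 - n0) N 0 ltac:(by rewrite subnKC) isT.
have s3 := @end_sum_shift U n0 (n1 - n0) N (n1 - n0) ltac:(by rewrite subnKC) (leqnn _).
rewrite addn0 in s2; rewrite subnKC// in s3.
have t0 : \sum_(m < K) end_sum q U N m <= pair_sum q U N.
  rewrite pair_sumE; apply: (sub_sum_le (r := 0)) => [m|]; first exact: end_sum_ge0.
  by move: KN; clear; lia.
have t1 : \sum_(m < K) end_sum q U N (N - m) <= pair_sum q U N.
  have -> : pair_sum q U N = \sum_(m < N.+1) end_sum q U N (N - m).
    rewrite pair_sumE (reindex_inj rev_ord_inj) /=.
    by apply: eq_bigr => m _; congr end_sum; clear; lia.
  apply: (sub_sum_le (r := 0) (g := fun m => end_sum q U N (N - m))) => [m|].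
    exact: end_sum_ge0.
  by move: KN; clear; lia.
have Kr : 0 <= K%:R^-1 :> R by rewrite invr_ge0.
have u0 := le_trans e0 (ler_wpM2r Kr t0).
have u1 := le_trans e1 (ler_wpM2r Kr t1).
have : C * (end_sum q (fun t => U (n0 + t)%N) (n1 - n0) 0 +
   end_sum q (fun t => U (n0 + t)%N) (n1 - n0) (n1 - n0)) <=
   C * (pair_sum q U N / K%:R + pair_sum q U N / K%:R).
  rewrite ler_pM2l// lerD//; first exact: le_trans s2 u0.
  exact: le_trans s3 u1.
rewrite [X in _ <= X -> _](_ : _ = 2 * C / K%:R * pair_sum q U N); last by ring.
by rewrite mulrDl mul1r; lra.
Qed.

End Cut.

(** The order of choice of the parameters: theta, then the block length K, and
    only then eps. *)
Lemma tiling_constants {R : realType} (C A c M r : R) :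
  0 <= C -> 0 <= A -> 0 <= c -> 0 < M -> 0 < r ->
  exists theta (K : nat), [/\ 0 < theta, (0 < K)%N & forall D eps (H : nat),
    0 <= D -> D <= (1 + C / K%:R) * M -> 0 <= eps -> (H <= K.+1)%N ->
    c * (eps * (5 * K%:R + 2)) <= r ->
    (1 + theta) * D + (1 + theta^-1) * 4 * A * D / K%:R +
    c * (eps * (3 * K%:R + 2 * H%:R)) <= M + 4 * r].
Proof.
move=> C0 A0 c0 M0 r0.
pose theta := r / (M + r).
have Mr : 0 < M + r by rewrite addr_gt0.
have th0 : 0 < theta by rewrite divr_gt0.
have thV : 0 <= theta^-1 by rewrite invr_ge0 ltW.
pose B := (1 + theta^-1) * 4 * A * (M + r).
have B0 : 0 <= B by rewrite /B; nonneg.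
pose X := (C * M + B) / r.
have X0 : 0 <= X by rewrite /X; nonneg.
exists theta, (Num.truncn X).+1; split=> //.
set K := _.+1; move=> D eps H D0 DM eps0 HK small.
have K0 : 0 < K%:R :> R by rewrite ltr0n.
have KX : (C * M + B) <= r * K%:R.
  by rewrite [leRHS]mulrC -ler_pdivrMr//; exact: ltW (truncnS_gt X).
have CM0 : 0 <= C * M by nonneg.
have DMr : D <= M + r.
  apply: (le_trans DM); rewrite mulrDl mul1r lerD2l mulrAC ler_pdivrMr//.
  by lra.
have e1 : (1 + theta) * D <= M + 2 * r.
  apply: (@le_trans _ _ ((1 + theta) * (M + r))).
    by rewrite ler_wpM2l// addr_ge0// ltW.
  by rewrite /theta mulrDl mul1r divfK ?gt_eqF//; lra.
have e2 : (1 + theta^-1) * 4 * A * D / K%:R <= r.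
  rewrite ler_pdivrMr//; apply: (@le_trans _ _ B); last by lra.
  by rewrite /B ler_wpM2l//; nonneg.
have e3 : c * (eps * (3 * K%:R + 2 * H%:R)) <= r.
  apply: le_trans small; do 2 rewrite ler_wpM2l//.
  have : H%:R <= K%:R + 1 :> R by rewrite natr1 ler_nat.
  by lra.
by lra.
Qed.

(** * The L2 norm *)

Section L2Norm.
Context {d} {T : measurableType d} {R : realType} (mu : {measure set T -> \bar R}).
Implicit Types (f g h : T -> R).

Lemma ae_imply (P Q : T -> Prop) : (forall x, P x -> Q x) ->
  {ae mu, forall x, P x} -> {ae mu, forall x, Q x}.
Proof. by move=> PQ; apply: filterS. Qed.

Lemma ae_imply2 (P Q S : T -> Prop) : (forall x, P x -> Q x -> S x) ->
  {ae mu, forall x, P x} -> {ae mu, forall x, Q x} -> {ae mu, forall x, S x}.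
Proof. by move=> PQS; apply: filterS2. Qed.

Definition l2 f : \bar R := 'N[mu]_2[EFin \o f]%E.

Lemma l2_ge0 f : (0 <= l2 f)%E. Proof. exact: Lnorm_ge0. Qed.

Lemma l2E f : l2 f = ((\int[mu]_x (f x ^+ 2)%:E) `^ 2^-1)%E.
Proof.
rewrite /l2 unlock /=; congr (_ `^ _)%E; apply: eq_integral => x _ /=.
by rewrite powR_mulrn// real_normK// num_real.
Qed.

Lemma l2_mono f g : measurable_fun setT f -> measurable_fun setT g ->
  {ae mu, forall x, `|f x| <= `|g x|} -> (l2 f <= l2 g)%E.
Proof.
move=> mf mg fg; rewrite !l2E gt0_ler_poweR//.
- by rewrite in_itv/= leey integral_ge0// => x _; rewrite lee_fin sqr_ge0.
- by rewrite in_itv/= leey integral_ge0// => x _; rewrite lee_fin sqr_ge0.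
apply: ae_ge0_le_integral => //.
- by move=> x _; rewrite lee_fin sqr_ge0.
- by apply/measurable_EFinP; exact: measurable_funX.
- by move=> x _; rewrite lee_fin sqr_ge0.
- by apply/measurable_EFinP; exact: measurable_funX.
apply: filterS fg => x fg _ /=.
by rewrite lee_fin -(real_normK (num_real (f x))) -(real_normK (num_real (g x))) lerXn2r// nnegrE.
Qed.

Lemma l2D f g : measurable_fun setT f -> measurable_fun setT g ->
  (l2 (f \+ g)%R <= l2 f + l2 g)%E.
Proof. by move=> mf mg; apply: eminkowski => //; rewrite lee1n. Qed.

Lemma l2N f : l2 (\- f) = l2 f.
Proof. by rewrite /l2 -[RHS]oppe_Lnorm. Qed.

Lemma l2_indic (A : set T) (c : R) : measurable A ->
  l2 (fun x => c * \1_A x) = (((c ^+ 2)%:E * mu A) `^ 2^-1)%E.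
Proof.
move=> mA; rewrite l2E; congr (_ `^ _)%E.
under eq_integral => x _.
  rewrite (_ : ((c * \1_A x) ^+ 2)%:E = ((c ^+ 2)%:E * (\1_A x)%:E)%E).
    over.
  rewrite -EFinM exprMn indicE.
  by case: (x \in A); rewrite ?expr1n ?expr0n.
rewrite ge0_integralZl//.
- by rewrite integral_indic// setIT.
- by apply/measurable_EFinP; exact: measurable_indic.
- by rewrite lee_fin sqr_ge0.
Qed.

Lemma l2_indic_le (A B : set T) (c : R) : measurable A -> measurable B ->
  (mu A <= mu B)%E -> (l2 (fun x => (c * \1_A x)%R) <= l2 (fun x => (c * \1_B x)%R))%E.
Proof.
move=> mA mB AB; rewrite !l2_indic// gt0_ler_poweR//.
- by rewrite in_itv/= leey mule_ge0// lee_fin sqr_ge0.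
- by rewrite in_itv/= leey mule_ge0// lee_fin sqr_ge0.
- by rewrite lee_pmul// lee_fin sqr_ge0.
Qed.

Lemma l2_bounded f (h m : R) : measurable_fun setT f -> 0 <= h -> 0 <= m ->
  (mu setT <= m%:E)%E -> {ae mu, forall x, `|f x| <= h} ->
  (l2 f <= (h * Num.sqrt m)%:E)%E.
Proof.
move=> mf h0 m0 mum fh.
apply: (@le_trans _ _ (l2 (fun x => h * \1_setT x))).
  apply: l2_mono => //.
    by apply: measurable_funM => //; exact: measurable_indic.
  by apply: filterS fh => x fx; rewrite indicT mulr1 (ger0_norm h0).
rewrite l2_indic//.
apply: (@le_trans _ _ ((h ^+ 2 * m)%:E `^ 2^-1)%E).
  rewrite gt0_ler_poweR//.
  - by rewrite in_itv/= leey mule_ge0// lee_fin sqr_ge0.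
  - by rewrite in_itv/= leey lee_fin mulr_ge0// sqr_ge0.
  - by rewrite (EFinM _ m) lee_pmul// lee_fin sqr_ge0.
rewrite lee_fin powR12_sqrt ?mulr_ge0 ?sqr_ge0//.
by rewrite sqrtrM ?sqr_ge0// sqrtr_sqr ger0_norm.
Qed.

(** Absolute continuity of the integral of f^2. *)
Lemma l2_tail_small f (r : R) : measurable_fun setT f -> (l2 f < +oo)%E -> 0 < r ->
  exists2 s : R, 0 < s & forall A, measurable A -> (mu A < s%:E)%E ->
    (l2 (fun x => (f x * \1_A x)%R) < r%:E)%E.
Proof.
move=> mf ff r0.
have sqint : mu.-integrable setT (EFin \o (fun x => f x ^+ 2)).
  apply: Lfun2_integrable_sqr; rewrite inE; apply/andP; split; rewrite inE//.
have [s [s0 H]] := integral_normr_continuous sqint (exprn_gt0 2 r0).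
exists s => // A mA As; have := H A mA As.
have -> : r%:E = ((r ^+ 2)%:E `^ 2^-1)%E.
  by rewrite /= powR12_sqrt ?sqr_ge0// sqrtr_sqr ger0_norm// ltW.
rewrite l2E.
have msq : measurable_fun setT (fun x => f x ^+ 2) by exact: measurable_funX.
have -> : (\int[mu]_x ((f x * \1_A x) ^+ 2)%:E = \int[mu]_(x in A) (f x ^+ 2)%:E)%E.
  rewrite [RHS]integral_mkcond; apply: eq_integral => x _.
  rewrite patchE indicE; case: ifPn => xA; first by rewrite mulr1.
  by rewrite mulr0 expr0n.
rewrite /Rintegral.
have intA : (\int[mu]_(x in A) (f x ^+ 2)%:E < +oo)%E.
  case/integrableP : (integrableS measurableT mA (@subsetT _ A) sqint) => _.
  by under eq_integral => x _ do rewrite /= ger0_norm ?sqr_ge0//.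
have int0 : (0 <= \int[mu]_(x in A) (f x ^+ 2)%:E)%E.
  by apply: integral_ge0 => x _; rewrite lee_fin sqr_ge0.
under [X in fine X < _]eq_integral => x _ do rewrite ger0_norm ?sqr_ge0//.
move: intA int0; case: (\int[mu]_(x in A) _)%E => // z _; rewrite lee_fin => z0 /= zr.
by rewrite ?poweR_EFin lte_fin gt0_ltr_powR// nnegrE// sqr_ge0.
Qed.

(** Closeness of W to y when the approximation U of y is known to be close to W
    only outside S1.  On S1 the function W is close to a constant A; the norm of
    A on S1 is at most its norm on the larger set S2, where U is close to A, and
    U is close to y, which is small in norm there. *)
Lemma l2_split_cell (S1 S2 : set T) (W U y : T -> R) (A h m : R) :
  measurable S1 -> measurable S2 -> measurable_fun setT W ->
  measurable_fun setT U -> measurable_fun setT y ->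
  0 <= h -> 0 <= m -> (mu setT <= m%:E)%E -> (mu S1 <= mu S2)%E ->
  {ae mu, forall x, [/\ ~ S1 x -> `|W x - U x| <= h, S1 x -> `|W x - A| <= h &
     S2 x -> `|U x - A| <= h]} ->
  (l2 (fun x => (W x - y x)%R) <=
   2%:E * (h * Num.sqrt m)%:E + 2%:E * l2 (fun x => (U x - y x)%R) +
   (l2 (fun x => (y x * \1_S1 x)%R) + l2 (fun x => (y x * \1_S2 x)%R)))%E.
Proof.
move=> mS1 mS2 mW mU my h0 m0 mum S12 near.
have mI (S : set T) : measurable S -> measurable_fun setT (\1_S : T -> R).
  by move=> mS; exact: measurable_indic.
pose g0 x := W x - (A * \1_S1 x + U x * \1_(~` S1) x).
pose gA (S : set T) x := A * \1_S x.
pose gy (S : set T) x := y x * \1_S x.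
pose gd (S : set T) x := (U x - y x) * \1_S x.
pose ge (S : set T) x := (A - U x) * \1_S x.
have mg0 : measurable_fun setT g0.
  apply: measurable_funB => //; apply: measurable_funD; apply: measurable_funM => //.
  by apply: mI; exact: measurableC.
have mgA S : measurable S -> measurable_fun setT (gA S).
  by move=> mS; apply: measurable_funM; [by [] | exact: mI].
have mgy S : measurable S -> measurable_fun setT (gy S).
  by move=> mS; apply: measurable_funM; [by [] | exact: mI].
have mgd S : measurable S -> measurable_fun setT (gd S).
  move=> mS; apply: measurable_funM; last exact: mI.
  exact: measurable_funB.
have mge S : measurable S -> measurable_fun setT (ge S).
  move=> mS; apply: measurable_funM; last exact: mI.
  exact: measurable_funB.
have mS1c := measurableC mS1.
have bg0 : (l2 g0 <= (h * Num.sqrt m)%:E)%E.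
  apply: l2_bounded => //; apply: ae_imply near => x [n1 n2 _].
  rewrite /g0 !indicE in_setC; case: (boolP (x \in S1)) => [/set_mem xS|/negP nxS].
    by rewrite mulr1 mulr0 addr0; exact: n2.
  by rewrite mulr1 mulr0 add0r; apply: n1 => xS; apply: nxS; exact: mem_set.
have bge : (l2 (ge S2) <= (h * Num.sqrt m)%:E)%E.
  apply: l2_bounded => //; first exact: mge.
  apply: ae_imply near => x [_ _ n3].
  rewrite /ge indicE; case: (boolP (x \in S2)) => [/set_mem xS|_].
    by rewrite mulr1 distrC; exact: n3.
  by rewrite mulr0 normr0.
have bgd S : measurable S -> (l2 (gd S) <= l2 (fun x => (U x - y x)%R))%E.
  move=> mS; apply: l2_mono; first exact: mgd.
    exact: measurable_funB.
  apply: aeW => x /=; rewrite /gd normrM indicE.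
  by case: (x \in S); rewrite ?normr1 ?mulr1// normr0 mulr0.
have e1 : (fun x => W x - y x) = (g0 \+ ((gA S1 \+ (\- gy S1)) \+ gd (~` S1))).
  apply/funext => x; rewrite /g0 /gA /gy /gd /= !indicE in_setC.
  by case: (x \in S1); rewrite /=; ring.
have e2 : gA S2 = (ge S2 \+ (gd S2 \+ gy S2)).
  by apply/funext => x; rewrite /gA /ge /gd /gy /=; ring.
have mNy : measurable_fun setT (\- gy S1) by apply: measurableT_comp => //; exact: mgy.
have t1 : (l2 (gA S2) <= (h * Num.sqrt m)%:E + (l2 (fun x => (U x - y x)%R) + l2 (gy S2)))%E.
  rewrite e2; apply: le_trans (l2D _ _) _; first exact: mge.
    by apply: measurable_funD; [exact: mgd|exact: mgy].
  apply: leeD => //; apply: le_trans (l2D _ _) _; [exact: mgd|exact: mgy|].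
  by apply: leeD => //; exact: bgd.
have t2 : (l2 (gA S1) <= l2 (gA S2))%E by exact: l2_indic_le.
have := l2D mg0 (measurable_funD (measurable_funD (mgA _ mS1) mNy) (mgd _ mS1c)).
rewrite -e1 => /le_trans; apply.
apply: (@le_trans _ _ ((h * Num.sqrt m)%:E + (((h * Num.sqrt m)%:E +
   (l2 (fun x => (U x - y x)%R) + l2 (gy S2)) + l2 (gy S1)) + l2 (fun x => (U x - y x)%R)))%E).
  apply: leeD => //; apply: le_trans (l2D _ _) _.
  - by apply: measurable_funD => //; exact: mgA.
  - exact: mgd.
  apply: leeD; last exact: bgd.
  apply: le_trans (l2D _ _) _; [exact: mgA|exact: mNy|].
  apply: leeD; first exact: le_trans t1.
  by rewrite l2N.
set X := l2 (fun x => (U x - y x)%R); set Y1 := l2 (gy S1); set Y2 := l2 (gy S2).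
rewrite !mule_natl !mule2n -/Y1 -/Y2 le_eqVlt; apply/orP; left; apply/eqP.
set H := (_ * _)%:E.
by rewrite !addeA [LHS]addeAC (addeAC _ Y2 X) [LHS]addeAC.
Qed.

End L2Norm.

(** * Piecewise-constant functions on an interval *)

Section LebesgueOnInterval.
Context {R : realType} (I : interval R).
Local Notation mu := (lebesgue_on I).

Lemma lebesgue_onE (A : set R) : mu A = lebesgue_measure (A `&` [set` I]).
Proof. by []. Qed.

Lemma lebesgue_on_null (A : set R) : measurable A ->
  lebesgue_measure (A `&` [set` I]) = 0%E -> {ae mu, forall x, ~ A x}.
Proof. by move=> mA A0; exists A; split => // x /=; apply: contrapT. Qed.

Lemma ae_in_itv : {ae mu, forall x, x \in I}.
Proof.
have mI : measurable (~` [set` I] : set R) by apply: measurableC; exact: measurable_itv.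
have := lebesgue_on_null mI; rewrite setICl measure0 => /(_ erefl).
by apply: ae_imply => x /= /contrapT.
Qed.

Lemma lebesgue_on_le (A B : set R) (m : R) : measurable A -> measurable B ->
  A `&` [set` I] `<=` B -> (lebesgue_measure B <= m%:E)%E -> (mu A <= m%:E)%E.
Proof.
move=> mA mB AB; apply: le_trans; rewrite lebesgue_onE.
apply: le_measure; rewrite ?inE//; apply: measurableI => //; exact: measurable_itv.
Qed.

Lemma ae_not_countable (A : set R) : countable A -> {ae mu, forall x, ~ A x}.
Proof.
move=> cA; apply: lebesgue_on_null; first exact: countable_measurable.
by apply: countable_lebesgue_measure0; apply: sub_countable cA; exact: subset_card_le.
Qed.

End LebesgueOnInterval.

Section PiecewiseConstant.
Context {R : realType} (I : interval R) (a b : R).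
Hypothesis Iab : has_ends I a b.
Local Notation mu := (lebesgue_on I).

Lemma lebesgue_on_itvT : (mu setT <= (b - a)%:E)%E.
Proof.
have [ab Ile _] := Iab.
apply: (@lebesgue_on_le _ _ _ [set` `[a, b]]) => //.
- by move=> x [_ /= xI]; rewrite in_itv/= Ile.
- by rewrite lebesgue_measure_itv /= lte_fin ab -EFinB.
Qed.

Lemma Lfun_bounded (f : R -> R) (h : R) : measurable_fun setT f ->
  (forall x, `|f x| <= h) -> f \in Lfun mu 2%:E.
Proof.
move=> mf fh; have [ab _ _] := Iab.
rewrite inE; apply/andP; split; rewrite inE//=.
rewrite /finite_norm; apply: (@le_lt_trans _ _ (h * Num.sqrt (b - a))%:E).
  apply: (l2_bounded (mu := mu)) => //.
  - by apply: le_trans (fh 0).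
  - by rewrite subr_ge0 ltW.
  - exact: lebesgue_on_itvT.
  - exact: aeW.
by rewrite ltry.
Qed.

Section Step.
Variables (eta : R) (p : int) (N : nat) (w : int -> R).
Hypotheses (eta_gt0 : 0 < eta) (rng : node_range eta I p N).

Let midpoint (j : nat) : R := eta * (p%:~R + j%:R + 2^-1).

(** The piecewise-constant extension, written as a sum of jumps at the midpoints
    between consecutive nodes so that its measurability is immediate. *)
Definition step (x : R) : R :=
  w p + \sum_(j < N) (w (p + j.+1%:Z) - w (p + j%:Z)) * \1_[set y | midpoint j <= y] x.

Lemma measurable_step : measurable_fun setT step.
Proof.
apply: measurable_funD => //; apply: measurable_sum => j.
apply: measurable_funM => //; apply: measurable_indic.
rewrite (_ : mkset _ = [set` `[midpoint j, +oo[]); first exact: measurable_itv.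
by apply/seteqP; split => x /=; rewrite in_itv/= andbT.
Qed.

Lemma step_bounded : exists h, forall x, `|step x| <= h.
Proof.
exists (`|w p| + \sum_(j < N) `|w (p + j.+1%:Z) - w (p + j%:Z)|) => x.
apply: le_trans (ler_normD _ _) _; rewrite lerD2l.
apply: le_trans (ler_norm_sum _ _ _) _; apply: ler_sum => j _.
rewrite normrM indicE; case: (x \in _); rewrite ?normr1 ?mulr1//.
by rewrite normr0 mulr0.
Qed.

Lemma step_nearest x (k : nat) : (k <= N)%N -> (forall j, midpoint j != x) ->
  (forall j, (j <= N)%N -> `|x - eta * (p%:~R + k%:R)| <= `|x - eta * (p%:~R + j%:R)|) ->
  step x = w (p + k%:Z).
Proof.
move=> kN notmid near.
have closer (u v : R) : u < v -> `|x - u| <= `|x - v| -> x <= (u + v) / 2.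
  by move=> uv; rewrite ler_norml; case: (ger0P (x - v)) => ?; case/andP => ? ?; lra.
have closer' (u v : R) : u < v -> `|x - v| <= `|x - u| -> (u + v) / 2 <= x.
  by move=> uv; rewrite ler_norml; case: (ger0P (x - u)) => ?; case/andP => ? ?; lra.
have lo (j : nat) : (j < k)%N -> midpoint j <= x.
  move=> jk; have := closer' (eta * (p%:~R + j%:R)) (eta * (p%:~R + k%:R)).
  rewrite ltr_pM2l// ltrD2l ltr_nat jk => /(_ isT (near _ (leq_trans (ltnW jk) kN))).
  apply: le_trans; rewrite -mulrDr -mulrA ler_pM2l//.
  have : j.+1%:R <= k%:R :> R by rewrite ler_nat.
  by rewrite -natr1; lra.
have hi (j : nat) : (k <= j < N)%N -> x < midpoint j.
  move=> /andP[kj jN]; rewrite lt_neqAle eq_sym notmid /=.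
  have := closer (eta * (p%:~R + k%:R)) (eta * (p%:~R + j.+1%:R)).
  rewrite ltr_pM2l// ltrD2l ltr_nat ltnS kj => /(_ isT (near _ jN)).
  move=> /le_trans; apply; rewrite -mulrDr -mulrA ler_pM2l//.
  have : k%:R <= j%:R :> R by rewrite ler_nat.
  by rewrite -natr1; lra.
rewrite /step (eq_bigr (fun j : 'I_N => if (j < k)%N then
    w (p + j.+1%:Z) - w (p + j%:Z) else 0)); last first.
  move=> j _; rewrite indicE; case: ltnP => jk.
    by rewrite mem_set ?mulr1//=; exact: lo.
  rewrite memNset ?mulr0//= => mx.
  by have := hi j; rewrite jk ltn_ord => /(_ isT); rewrite ltNge mx.
rewrite -big_mkcond /= (big_ord_narrow kN) /=.
rewrite -(big_mkord xpredT (fun j => w (p + j.+1%:Z) - w (p + j%:Z))).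
by rewrite (telescope_sumr (fun j : nat => w (p + j%:Z)))// addr0 addrC subrK.
Qed.

(** The midpoints, which have two nearest nodes, form a null set. *)
Lemma pc_extension_exists : exists W : L2 I, pc_extension eta I w W.
Proof.
have [h hb] := step_bounded.
exists (Lfun_Sub (lee1n 2) (Lfun_bounded measurable_step hb)).
have cm : countable (range midpoint) by apply: card_le_trans (card_image_le _ _) _.
have := ae_not_countable I cm; apply: ae_imply => x nx i.
rewrite rng => -[k kN ->] near /=.
apply: step_nearest => //.
  by move=> j; apply/eqP => jx; apply: nx; exists j.
move=> j jN; have := near (p + j%:Z); rewrite !intr_addn; apply.
by exists j.
Qed.

End Step.

Lemma nearest_node (eta x : R) (p : int) (N : nat) : 0 < eta ->
  node_range eta I p N -> eta * (p%:~R - 1) <= a -> b <= eta * (p%:~R + N%:R + 1) ->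
  x \in I -> exists2 k, (k <= N)%N & `|x - eta * (p%:~R + k%:R)| <= eta /\
   forall j, (j <= N)%N -> `|x - eta * (p%:~R + k%:R)| <= `|x - eta * (p%:~R + j%:R)|.
Proof.
move=> eta0 rng pa Nb xI; have [ab Ile _] := Iab; have /andP[ax xb] := Ile _ xI.
pose dist (k : 'I_N.+1) := `|x - eta * (p%:~R + k%:R)|.
have [k _ kmin] := @Order.TotalTheory.arg_minP _ R _ (ord0 : 'I_N.+1) xpredT dist isT.
have near j : (j <= N)%N -> dist k <= `|x - eta * (p%:~R + j%:R)|.
  by move=> jN; have := kmin (Ordinal (jN : (j < N.+1)%N)) isT.
exists k; first by rewrite -ltnS.
split=> //; rewrite -/(dist k) leNgt; apply/negP => far.
have [xk|kx] := leP x (eta * (p%:~R + k%:R)).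
  have kd : dist k = eta * (p%:~R + k%:R) - x by rewrite /dist ler0_norm ?subr_le0// opprB.
  have k0 : (0 < k)%N.
    rewrite lt0n; apply/eqP => k0; move: far; rewrite kd k0 addr0.
    by move: pa; rewrite mulrBr mulr1; lra.
  have := near k.-1 (leq_trans (leq_pred _) (ltn_ord k : (k <= N)%N)).
  have kE : k%:R = k.-1%:R + 1 :> R by rewrite natr1 prednK.
  rewrite kd leNgt => /negP; apply.
  move: far; rewrite kd kE !mulrDr mulr1 => far.
  rewrite ltr_norml; apply/andP; split; lra.
have kd : dist k = x - eta * (p%:~R + k%:R) by rewrite /dist ger0_norm ?subr_ge0// ltW.
have kN : (k < N)%N.
  rewrite ltn_neqAle -ltnS ltn_ord andbT; apply/eqP => kN.
  move: far; rewrite kd kN; move: Nb; rewrite [_ * (_ + 1)]mulrDr mulr1; lra.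
have := near k.+1 kN; rewrite kd leNgt => /negP; apply.
move: far; rewrite kd -natr1 !mulrDr mulr1 => far.
rewrite ltr_norml; apply/andP; split; lra.
Qed.

Lemma pc_extension_near (eta : R) (p : int) (N : nat) (w z : int -> R) (W Z : R -> R) :
  0 < eta -> node_range eta I p N -> eta * (p%:~R - 1) <= a ->
  b <= eta * (p%:~R + N%:R + 1) ->
  pc_extension eta I w W -> pc_extension eta I z Z ->
  {ae mu, forall x, x \in I /\ exists2 k, (k <= N)%N &
     [/\ `|x - eta * (p%:~R + k%:R)| <= eta, W x = w (p + k%:Z) &
         Z x = z (p + k%:Z)]}.
Proof.
move=> eta0 rng pa Nb pcW pcZ.
have both := ae_imply2 (fun x P Q => conj P Q) pcW pcZ.
apply: ae_imply2 (ae_in_itv I) both => x xI [pcWx pcZx]; split=> //.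
have [k kN [kx near]] := nearest_node eta0 rng pa Nb xI.
have nk : nodes eta I (p + k%:Z) by rewrite rng; exists k.
have nearest j : nodes eta I j ->
    `|x - eta * (p + k%:Z)%:~R| <= `|x - eta * j%:~R|.
  by rewrite rng => -[j' j'N ->]; rewrite !intr_addn; apply: near.
by exists k => //; split=> //; [exact: pcWx | exact: pcZx].
Qed.

End PiecewiseConstant.

(** * Lower limits and recovery sequences *)

Section LimitBounds.
Context {R : realType}.
Local Open Scope ereal_scope.

Lemma le_limn_einf (u : (\bar R)^nat) (z : \bar R) :
  (\forall k \near \oo, z <= u k) -> z <= limn_einf u.
Proof.
move=> [m _ zu]; rewrite limn_einf_lim; apply: lime_ge; first exact: is_cvg_einfs.
by exists m => // n mn; apply: le_ereal_inf_tmp => _ [k /= nk <-]; apply: zu; exact: leq_trans nk.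
Qed.

Lemma limn_esup_le (u : (\bar R)^nat) (z : \bar R) :
  (\forall k \near \oo, u k <= z) -> limn_esup u <= z.
Proof.
move=> [m _ zu]; rewrite limn_esup_lim; apply: lime_le; first exact: is_cvg_esups.
by exists m => // n mn; apply: ge_ereal_sup => _ [k /= nk <-]; apply: zu; exact: leq_trans nk.
Qed.

End LimitBounds.

Section LowerLimit.
Context {R : realType} {X Y : Type}.
Implicit Types (close : R -> X -> Y -> Prop) (F : R -> X -> \bar R).

(** The Gamma-lower limit over the whole family eps -> 0; [close tau x y] says
    that x is tau-close to y, where the arguments x may be of another type than
    the limit y. *)
Definition lower_limit close F (y : Y) : \bar R :=
  ereal_sup [set z | exists2 tau : R, 0 < tau &
    z = ereal_inf [set v | exists e x, [/\ 0 < e < tau, close tau x y & v = F e x]]].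

Lemma lower_limit_lt close F y (M : R) : (lower_limit close F y < M%:E)%E ->
  forall tau, 0 < tau -> exists e x, [/\ 0 < e < tau, close tau x y & (F e x < M%:E)%E].
Proof.
move=> GM tau tau0.
pose S := [set v | exists e x, [/\ 0 < e < tau, close tau x y & v = F e x]].
have : (ereal_inf S < M%:E)%E.
  by apply: le_lt_trans GM; apply: ereal_sup_ubound; exists tau.
by move=> /ereal_inf_lt[_ [e [x [ex cx ->]]] Fx]; exists e, x.
Qed.

Lemma lower_limit_ge0 close F y : (forall e x, 0 < e -> (0 <= F e x)%E) ->
  (0 <= lower_limit close F y)%E.
Proof.
move=> F0; apply: le_trans (ereal_sup_ubound _); last by exists 1; first exact: ltr01.
by apply: le_ereal_inf_tmp => _ [e [x [/andP[e0 _] _ ->]]]; exact: F0.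
Qed.

Lemma lower_limit_liminf close F (x : nat -> X) y (eps : nat -> R) :
  (forall k, 0 < eps k) -> eps @ \oo --> (0 : R) ->
  (forall delta, 0 < delta -> \forall k \near \oo, close delta (x k) y) ->
  (lower_limit close F y <= limn_einf (fun k => F (eps k) (x k)))%E.
Proof.
move=> eps0 epsc xy; apply: ge_ereal_sup => _ [tau tau0 ->].
apply: le_limn_einf.
have [m1 _ H1] := xy _ tau0.
have /cvgrPdist_lt /(_ _ tau0)[m2 _ H2] := epsc.
exists (maxn m1 m2) => // k /=; rewrite geq_max => /andP[k1 k2].
apply: ereal_inf_lbound; exists (eps k), (x k); split=> //; last exact: H1.
rewrite eps0 /=; have := H2 k k2; rewrite sub0r normrN gtr0_norm//.
Qed.

End LowerLimit.

Section Transfer.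
Context {R : realType} {X X' Y : Type}.

(** The premise says that the lower limit of F at y is at most M; the conclusion
    is what a recovery sequence for F' at y is made of. *)
Definition transfers (close : R -> X -> Y -> Prop) (F : R -> X -> \bar R)
    (close' : R -> X' -> Y -> Prop) (F' : R -> X' -> \bar R) (y : Y) : Prop :=
  forall M M' : R,
  (forall tau, 0 < tau ->
     exists e x, [/\ 0 < e < tau, close tau x y & (F e x < M%:E)%E]) ->
  M < M' -> forall delta, 0 < delta -> exists2 tau, 0 < tau &
  forall eta, 0 < eta < tau -> exists x', close' delta x' y /\ (F' eta x' <= M'%:E)%E.

Variables (close : R -> X -> Y -> Prop) (F : R -> X -> \bar R).
Variables (close' : R -> X' -> Y -> Prop) (F' : R -> X' -> \bar R) (y : Y).
Hypothesis FF' : transfers close F close' F' y.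


Hypothesis F_ge0 : forall e x, 0 < e -> (0 <= F e x)%E.

Lemma lower_limit_fin : lower_limit close F y = +oo%E \/
  exists2 g : R, lower_limit close F y = g%:E &
    forall r, 0 < r -> forall tau, 0 < tau ->
    exists e x, [/\ 0 < e < tau, close tau x y & (F e x < (g + r)%:E)%E].
Proof.
have G0 : (0 <= lower_limit close F y)%E by exact: lower_limit_ge0.
case E : (lower_limit close F y) G0 => [g| |] // _; [right|by left].
exists g => // r r0; apply: lower_limit_lt.
by rewrite E lte_fin ltrDl.
Qed.

Lemma lower_limit_transfer : (lower_limit close' F' y <= lower_limit close F y)%E.
Proof.
have [->|[g -> near_g]] := lower_limit_fin; first by rewrite leey.
apply/lee_addgt0Pr => r r0; apply: ge_ereal_sup => _ [tau tau0 ->].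
have r20 : 0 < r / 2 by rewrite divr_gt0.
have rr : g + r / 2 < g + r by rewrite ltrD2l; lra.
have [t t0 H] := FF' (near_g _ r20) rr tau0.
pose eta := Num.min t tau / 2.
have m0 : 0 < Num.min t tau by rewrite lt_min t0.
have m1 : eta < Num.min t tau by rewrite /eta; lra.
have e0 : 0 < eta by rewrite /eta; lra.
have [x' [cx Fx]] : exists x', close' tau x' y /\ (F' eta x' <= (g + r)%:E)%E.
  by apply: H; rewrite e0 (lt_le_trans m1)// ge_min lexx.
apply: le_trans Fx; apply: ereal_inf_lbound; exists eta, x'; split=> //.
by rewrite e0 (lt_le_trans m1)// ge_min lexx orbT.
Qed.

(** At step k take an argument which is the best one, among the tolerances
    1 / (n + 1) with n <= k, for both the distance to y and the excess of F'. *)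
Lemma recovery_sequence (eps : nat -> R) (x0 : X') :
  (forall k, 0 < eps k) -> eps @ \oo --> (0 : R) ->
  (forall delta, 0 < delta -> close' delta x0 y) ->
  (forall d d' x, d <= d' -> close' d x y -> close' d' x y) ->
  exists x' : nat -> X',
    (forall delta, 0 < delta -> \forall k \near \oo, close' delta (x' k) y) /\
    (limn_esup (fun k => F' (eps k) (x' k)) <= lower_limit close F y)%E.
Proof.
move=> eps0 epsc close0 mono.
have [->|[g -> near_g]] := lower_limit_fin.
  by exists (fun=> x0); split; [move=> d d0; exists 0%N => // k _; exact: close0|exact: leey].
pose good n k x' := close' n.+1%:R^-1 x' y /\ (F' (eps k) x' <= (g + n.+1%:R^-1)%:E)%E.
have ev n : \forall k \near \oo, exists x', good n k x'.
  have n0 : 0 < n.+1%:R^-1 :> R by rewrite invr_gt0.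
  have n20 : 0 < n.+1%:R^-1 / 2 :> R by rewrite divr_gt0.
  have lt2 : g + n.+1%:R^-1 / 2 < g + n.+1%:R^-1.
    by rewrite ltrD2l ltr_pdivrMr// ltr_pMr// ltr1n.
  have [t t0 H] := FF' (near_g _ n20) lt2 n0.
  have /cvgrPdist_lt /(_ _ t0)[m _ Hm] := epsc.
  exists m => // k mk; have [x' [c e]] : exists x', close' n.+1%:R^-1 x' y /\
      (F' (eps k) x' <= (g + n.+1%:R^-1)%:E)%E.
    apply: H; rewrite eps0 /=.
    by have := Hm k mk; rewrite sub0r normrN gtr0_norm.
  by exists x'.
pose best k := (\max_(n < k.+1 | `[< exists x', good n k x' >]) n)%N.
have /choice[x' Hx'] k : exists x', (exists x, good (best k) k x) -> good (best k) k x'.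
  have [[x gx]|no] := pselect (exists x, good (best k) k x); first by exists x.
  by exists x0.
have late n : \forall k \near \oo, exists2 n', (n <= n')%N & good n' k (x' k).
  have [m _ Hm] := ev n; exists (maxn m n) => // k /=.
  rewrite geq_max => /andP[mk nk]; exists (best k).
    have nk1 : (n < k.+1)%N by rewrite ltnS.
    apply: (@leq_bigmax_cond _ (fun i : 'I_k.+1 => `[< exists x', good i k x' >])
      (fun i : 'I_k.+1 => i : nat) (Ordinal nk1)).
    by apply/asboolP; exact: Hm.
  apply: Hx'.
  have nk1 : (n < k.+1)%N by rewrite ltnS.
  have Pn : `[< exists x', good (Ordinal nk1 : nat) k x' >] by apply/asboolP; exact: Hm.
  have [i Pi iE] := @eq_bigmax_cond _ (fun i : 'I_k.+1 => `[< exists x', good i k x' >])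
    (fun i : 'I_k.+1 => i : nat) (introT card_gt0P (ex_intro _ (Ordinal nk1) Pn)).
  by rewrite /best iE; apply/asboolP.
have small (d : R) : 0 < d -> exists n, forall n', (n <= n')%N -> n'.+1%:R^-1 <= d.
  move=> d0; exists (Num.truncn d^-1) => n' nn'.
  rewrite -[leRHS]invrK lef_pV2 ?posrE ?invr_gt0//.
  rewrite (le_trans (ltW (truncnS_gt _)))// ler_nat ltnS //.
exists x'; split.
  move=> d d0; have [n Hn] := small d d0; have [m _ Hm] := late n.
  exists m => // k mk; have [n' nn' [c _]] := Hm k mk.
  exact: mono (Hn _ nn') c.
apply/lee_addgt0Pr => r r0; apply: limn_esup_le.
have [n Hn] := small r r0; have [m _ Hm] := late n.
exists m => // k mk; have [n' nn' [_ Fk]] := Hm k mk.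
by apply: le_trans Fk _; rewrite -EFinD lee_fin lerD2l Hn.
Qed.

End Transfer.

(** * From the nonlocal energy to the two-field energy *)

Lemma clamp_index (k n0 m K N : nat) : (n0 < K)%N -> (k <= N)%N -> (N < n0 + m + K)%N ->
  exists2 t, (t <= m)%N & (k <= n0 + t + K)%N /\ (n0 + t <= k + K)%N.
Proof. by move=> n0K kN Nm; exists (minn (k - n0) m); lia. Qed.

Lemma abs_node_shift {R : realType} (eps x : R) (p : int) (k n K : nat) : 0 < eps ->
  `|x - eps * (p%:~R + k%:R)| <= eps -> (k <= n + K)%N -> (n <= k + K)%N ->
  `|x - eps * (p%:~R + n%:R)| <= (K%:R + 1) * eps.
Proof.
move=> eps0; rewrite !ler_distl => /andP[x1 x2] kn nk.
have kn' : k%:R <= n%:R + K%:R :> R by rewrite -natrD ler_nat.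
have nk' : n%:R <= k%:R + K%:R :> R by rewrite -natrD ler_nat.
have := ler_wpM2l (ltW eps0) kn'; have := ler_wpM2l (ltW eps0) nk'.
by move: x1 x2; rewrite !mulrDr => *; apply/andP; split; lra.
Qed.

Section Transfers.
Context {R : realType} (f : R -> R) (c sigma : R) (I : interval R) (a b : R).
Hypotheses (f_ge0 : forall z, 0 <= f z) (f0c : f 0 <= c) (sigma_gt0 : 0 < sigma).
Hypothesis Iab : has_ends I a b.
Local Notation mu := (lebesgue_on I).
Let q := expR (- sigma).

Let q_gt0 : 0 < q. Proof. exact: expR_gt0. Qed.
Let q_lt1 : q < 1. Proof. by rewrite -expR0 ltr_expR oppr_lt0. Qed.

Definition L2_close (delta : R) (U y : L2 I) : Prop :=
  (l2 mu (fun x => (U x - y x)%R) < delta%:E)%E.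

Definition L2_pair_close (delta : R) (W : L2 I * L2 I) (y : L2 I) : Prop :=
  L2_close delta W.1 y /\ L2_close delta W.2 y.

Lemma measurable_L2 (U : L2 I) : measurable_fun setT (U : R -> R).
Proof. by have /andP[mU _] := LfunP U; rewrite inE in mU; exact: mU. Qed.

Lemma L2_close_trans (r1 r2 : R) (W U y : L2 I) :
  (l2 mu (fun x => (W x - U x)%R) <= r1%:E)%E -> L2_close r2 U y -> L2_close (r1 + r2) W y.
Proof.
move=> WU Uy; rewrite /L2_close.
have -> : (fun x => W x - y x) = (fun x => W x - U x) \+ (fun x => U x - y x).
  by apply/funext => x /=; ring.
apply: le_lt_trans (l2D _ _ _) _.
- by apply: measurable_funB; exact: measurable_L2.
- by apply: measurable_funB; exact: measurable_L2.
rewrite (EFinD r1 r2); apply: le_lt_trans (leeD2r _ WU) _.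
by rewrite lteD2lE.
Qed.

Lemma l2_le_sup (W U : L2 I) (h : R) : 0 <= h ->
  {ae mu, forall x, `|W x - U x| <= h} ->
  (l2 mu (fun x => (W x - U x)%R) <= (h * Num.sqrt (b - a))%:E)%E.
Proof.
move=> h0 WU; have [ab _ _] := Iab; apply: l2_bounded => //.
- by apply: measurable_funB; exact: measurable_L2.
- by rewrite subr_ge0 ltW.
- exact: lebesgue_on_itvT.
Qed.

Lemma tiling_L2 (eps : R) (p : int) (N H K : nat) (U V : nat -> R) (theta w : R) :
  0 < eps -> eps * p%:~R \in I -> eps * (p%:~R + N%:R) \in I ->
  eps * (p%:~R - H%:R) <= a -> b <= eps * (p%:~R + N%:R + H%:R) ->
  (0 < K < N)%N -> 0 < theta ->
  (forall n n', (n' <= n <= N)%N -> (n <= n' + (2 * K + H + 4))%N ->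
     eps * `|U n - U n'| <= w) ->
  let D := eps * \sum_(n < N) density f q U V n in
  let bound := (1 + theta) * D
    + (1 + theta^-1) * 4 * (chain_a q / chain_b q) * D / K%:R
    + c * (eps * (3 * K%:R + 2 * H%:R)) in
  forall delta, 0 < delta -> exists2 tau, 0 < tau &
  forall eta, 0 < eta < tau -> exists Wu Wv : L2 I,
  [/\ (E_functional f sigma eta (Wu, Wv) <= (bound + delta)%:E)%E,
      (F_functional f sigma eta Wu <= (bound + delta)%:E)%E,
      {ae mu, forall x, `|Wv x - Wu x| <= delta} &
      {ae mu, forall x, x \in I /\ forall t, (t <= N)%N ->
        `|x - eps * (p%:~R + t%:R)| <= (H%:R + 2) * eps ->
        `|Wu x - eps * U t| <= 3 * w + delta}].
Proof.
move=> eps0 pI NI aH bH KN th0 osc D bound delta d0.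
have [ab _ _] := Iab.
have [tau tau0 Htau] := tiling f_ge0 f0c sigma_gt0 Iab V eps0 pI NI aH bH KN th0 osc d0.
exists (Num.min tau ((b - a) / 2)).
  by rewrite lt_min tau0 divr_gt0// subr_gt0.
move=> eta /andP[eta0]; rewrite lt_min => /andP[eta1].
rewrite ltr_pdivlMr// mulrC => eta2.
have [u [v [Eb Fb vu near]]] := Htau eta eta0 eta1.
have [p' [N' [rng _ _ p'a N'b]]] := node_range_exists Iab eta0 eta2.
have [Wu pcu] := pc_extension_exists Iab u eta0 rng.
have [Wv pcv] := pc_extension_exists Iab v eta0 rng.
have both := pc_extension_near Iab eta0 rng p'a N'b pcu pcv.
exists Wu, Wv; split.
- apply: (@le_trans _ _ (two_field_energy f sigma eta I u v)%:E); last by rewrite lee_fin.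
  by apply: ereal_inf_lbound; exists u, v.
- apply: (@le_trans _ _ (nonlocal_energy f sigma eta I u)%:E); last by rewrite lee_fin.
  by apply: ereal_inf_lbound; exists u.
- by apply: ae_imply both => x [xI [k kN [_ -> ->]]]; exact: vu.
- apply: ae_imply both => x [xI [k kN [xk -> _]]]; split=> // t tN xt.
  apply: near tN xt => //; first by rewrite rng; exists k.
  by rewrite intr_addn.
Qed.

Lemma local_energy_ge0 eps u : 0 < eps -> 0 <= local_energy f eps I u.
Proof.
move=> e0; rewrite /local_energy mulr_ge0 ?(ltW e0)//.
by apply: fsumr_ge0 => i _.
Qed.

Lemma F_functional_ge0 eps (U : L2 I) : 0 < eps ->
  (0 <= F_functional f sigma eps U)%E.
Proof.
move=> e0; apply: le_ereal_inf_tmp => _ [u [_ ->]]; rewrite lee_fin.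
rewrite addr_ge0 ?local_energy_ge0// mulr_ge0 ?(ltW e0)//.
apply: fsumr_ge0 => i _; apply: fsumr_ge0 => j _.
by rewrite mulr_ge0 ?sqr_ge0 ?expR_ge0.
Qed.

Lemma E_functional_ge0 eps (W : L2 I * L2 I) : 0 < eps ->
  (0 <= E_functional f sigma eps W)%E.
Proof.
move=> e0; apply: le_ereal_inf_tmp => _ [u [v [_ _ ->]]]; rewrite lee_fin.
have a0 : 0 <= a_coef sigma by exact: ltW (chain_a_gt0 q_gt0 q_lt1).
have b0 : 0 <= b_coef sigma by exact: ltW (chain_b_gt0 q_gt0 q_lt1).
apply: addr_ge0; first (apply: addr_ge0; first exact: local_energy_ge0).
  apply: mulr_ge0; first exact: divr_ge0 a0 (ltW e0).
  by apply: fsumr_ge0 => i _; exact: sqr_ge0.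
apply: mulr_ge0; first exact: divr_ge0 b0 (ltW e0).
by apply: fsumr_ge0 => i _; exact: sqr_ge0.
Qed.

End Transfers.

(** The first field of the profile to be tiled is u between two well-chosen end
    nodes, the second one is the nearly optimal auxiliary field of [cut_ends]. *)
Lemma transfer_F_E {R : realType} (f : R -> R) (c sigma : R) (I : interval R)
    (a b : R) (y : L2 I) :
  (forall z, 0 <= f z) -> f 0 <= c -> 0 < sigma -> has_ends I a b ->
  transfers (@L2_close R I) (fun eps => F_functional f sigma eps)
            (@L2_pair_close R I) (fun eps => E_functional f sigma eps) y.
Proof.
move=> f_ge0 f0c sigma_gt0 Iab M M' small MM' delta delta0.
pose q := expR (- sigma).
have q_gt0 : 0 < q by exact: expR_gt0.
have q_lt1 : q < 1 by rewrite -expR0 ltr_expR oppr_lt0.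
have [ab Ile abI] := Iab.
have M0 : 0 < M.
  have [e [x [/andP[e0 _] _ Fx]]] := small 1 ltr01.
  by have := le_lt_trans (F_functional_ge0 sigma f_ge0 x e0) Fx; rewrite lte_fin.
have a0 := chain_a_gt0 q_gt0 q_lt1; have b0 := chain_b_gt0 q_gt0 q_lt1.
have c0 : 0 <= c := le_trans (f_ge0 0) f0c.
pose r := (M' - M) / 6.
have r0 : 0 < r by rewrite divr_gt0// subr_gt0.
have [C C0 cut] := cut_ends q_gt0 q_lt1.
have [theta [K [th0 K0 const]]] :=
  tiling_constants (ltW C0) (divr_ge0 (ltW a0) (ltW b0)) c0 M0 r0.
pose s := Num.sqrt (b - a); have s0 : 0 <= s by exact: sqrtr_ge0.
pose h := delta / (8 * (s + 1)).
have h0 : 0 < h by rewrite divr_gt0// mulr_gt0// ltr_wpDl.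
have hs : h * s <= delta / 8.
  have -> : delta / 8 = h * (s + 1).
    by rewrite /h; field; rewrite gt_eqF// ltr_wpDl.
  by rewrite ler_pM2l// lerDl.
pose w := h / 8; have w0 : 0 < w by rewrite divr_gt0.
pose L := (2 * K + K.+1 + 4)%N.
pose S := M / (2 * q).
have S0 : 0 < S by rewrite divr_gt0// mulr_gt0.
have LS0 : 0 < L%:R * S by rewrite mulr_gt0// ltr0n /L; clear; lia.
have cK0 : 0 < c * (5 * K%:R + 2) + 1 by rewrite ltr_wpDl// mulr_ge0// addr_ge0// mulr_ge0.
have K30 : 0 < 3 * K%:R + 3 :> R by rewrite ltr_wpDl// mulr_ge0.
pose tau0 := Num.min (Num.min (delta / 8) (r / (c * (5 * K%:R + 2) + 1)))
                     (Num.min ((b - a) / (3 * K%:R + 3)) (w ^+ 2 / (L%:R * S))).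
have tau0_gt0 : 0 < tau0.
  by rewrite !lt_min !divr_gt0 ?subr_gt0 ?exprn_gt0.
have [eps [X [/andP[eps0 epsT] Xy FX]]] := small tau0 tau0_gt0.
move: (epsT); rewrite !lt_min => /andP[/andP[eps1 eps2] /andP[eps3 eps4]].
rewrite ltr_pdivlMr// in eps2; rewrite ltr_pdivlMr// in eps3.
rewrite ltr_pdivlMr// in eps4.
have epsK : 0 <= eps * K%:R by rewrite mulr_ge0// ltW.
have e2ab : 2 * eps < b - a by move: eps3; rewrite mulrDr; lra.
have [_ [u [pcu ->]] Fu] := ereal_inf_lt FX.
rewrite lte_fin in Fu.
have [p [N [rng _ _ pa Nb]]] := node_range_exists Iab eps0 e2ab.
rewrite (nonlocal_energyE _ _ eps0 rng) in Fu.
pose U (n : nat) := u (p + n%:Z) / eps.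
rewrite -/q -/U in Fu.
have EU n : eps * U n = u (p + n%:Z) by rewrite /U mulrC divfK// gt_eqF.
(* At least 3 K bonds, so that more than K are left after the cuts. *)
have NK : (3 * K < N)%N.
  rewrite -(ltr_nat R) natrM -(ltr_pM2l eps0).
  by move: eps3 pa Nb; rewrite !mulrDr; lra.
have [n0 [n1 [Z [n0K n01 /andP[n1N Nn1] Zle]]]] := cut U N K K0 ltac:(by move: NK; clear; lia).
set N1 := (n1 - n0)%N in Zle.
pose U1 t := U (n0 + t)%N.
have fsum_ge0 n : 0 <= \sum_(i < n) f (U i.+1 - U i) by apply: sumr_ge0.
have pair0 := pair_sum_ge0 q_gt0 U N.
have oscU : forall n n', (n' <= n <= N)%N -> (n <= n' + L)%N -> eps * `|U n - U n'| <= w.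
  apply: (oscillation_le eps0 (ltW w0) (S := S)); last by rewrite ltW.
  rewrite /S ler_pdivlMr ?mulr_gt0//.
  have := increments_le_pair_sum q_gt0 U N; rewrite -(ler_pM2l eps0).
  have := mulr_ge0 (ltW eps0) (fsum_ge0 N).
  by move: Fu; rewrite mulrDr; lra.
have nodeI k : (k <= N)%N -> eps * (p + k%:Z)%:~R \in I.
  by move=> kN; suff : nodes eps I (p + k%:Z) by []; rewrite rng; exists k.
have n0N : (n0 <= N)%N by exact: leq_trans n1N.
have N1E : (n0 + N1 = n1)%N by rewrite subnKC.
have pI : eps * (p + n0%:Z)%:~R \in I by exact: nodeI.
have NI : eps * ((p + n0%:Z)%:~R + N1%:R) \in I.
  by rewrite intr_addn -addrA -natrD N1E -intr_addn; exact: nodeI.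
have aH : eps * ((p + n0%:Z)%:~R - K.+1%:R) <= a.
  apply: le_trans pa; rewrite ler_pM2l// intr_addn -natr1.
  have : n0%:R <= K%:R :> R by rewrite ler_nat ltnW.
  by lra.
have bH : b <= eps * ((p + n0%:Z)%:~R + N1%:R + K.+1%:R).
  apply: (le_trans Nb); rewrite ler_pM2l// intr_addn -addrA -addrA -[leRHS]addrA lerD2l.
  by rewrite addrA -!natrD N1E natr1 ler_nat; move: Nn1; clear; lia.
have KN1 : (0 < K < N1)%N by rewrite K0 /N1; move: NK n0K Nn1; clear; lia.
have osc1 n n' : (n' <= n <= N1)%N -> (n <= n' + (2 * K + K.+1 + 4))%N ->
    eps * `|U1 n - U1 n'| <= w.
  move=> nn' nL; apply: oscU.
    by move: nn' n1N N1E; clear; lia.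
  by move: nL; rewrite /L; clear; lia.
have rh0 : 0 < Num.min r h by rewrite lt_min r0.
have [tau tau_gt0 Htau] :=
  tiling_L2 f_ge0 f0c sigma_gt0 Iab Z eps0 pI NI aH bH KN1 th0 osc1 rh0.
exists tau => // eta /Htau[Wu [Wv [Eb _ Wvu near]]].
exists (Wu, Wv); split; last first.
  apply: (le_trans Eb); rewrite lee_fin.
  set D := eps * _.
  have D0 : 0 <= D.
    rewrite /D mulr_ge0 ?(ltW eps0)//; apply: sumr_ge0 => i _; exact: density_ge0.
  have DM : D <= (1 + C / K%:R) * M.
    apply: (@le_trans _ _ (eps * (\sum_(n < N) f (U n.+1 - U n) + (1 + C / K%:R) * pair_sum q U N))).
      rewrite /D ler_pM2l// /density big_split lerD//.
      have := @sub_sum_le R (fun n => f (U n.+1 - U n)) n0 N1 N (fun=> f_ge0 _).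
      rewrite N1E n1N => /(_ isT); apply: le_trans.
      by apply: ler_sum => i _; rewrite /U1 addnS.
    have CK : 0 <= C / K%:R by rewrite divr_ge0// ltW.
    have := ler_wpM2l CK (ltW Fu).
    have : 0 <= C / K%:R * (eps * \sum_(n < N) f (U n.+1 - U n)).
      by rewrite mulr_ge0// mulr_ge0// ltW.
    move: (ltW Fu); rewrite !mulrDl !mul1r !mulrDr.
    by rewrite [eps * (C / K%:R * _)]mulrCA; clear; lra.
  have := const D eps K.+1 D0 DM (ltW eps0) (leqnn _).
  have ecK : c * (eps * (5 * K%:R + 2)) <= r.
    by move: eps0 eps2; rewrite mulrCA !mulrDr mulr1; clear; lra.
  move=> /(_ ecK).
  have : Num.min r h <= r by rewrite ge_min lexx.
  by move: r0; rewrite (_ : M' = M + 6 * r); [clear; lra|rewrite /r; field].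
have pcX := pc_extension_near Iab eps0 rng pa Nb pcu pcu.
have WX : {ae lebesgue_on I, forall x, `|Wu x - X x| <= 2 * h}.
  apply: ae_imply2 near pcX => x [xI near] [_ [k kN [xk Xk _]]].
  have NN1 : (N < n0 + N1 + K)%N by rewrite N1E.
  have [t tN1 [kt tk]] := clamp_index n0K kN NN1.
  have xt : `|x - eps * ((p + n0%:Z)%:~R + t%:R)| <= (K.+1%:R + 2) * eps.
    rewrite intr_addn -(addrA p%:~R) -(natrD _ n0 t).
    apply: le_trans (abs_node_shift eps0 xk kt tk) _.
    by rewrite ler_pM2r// -natr1 -addrA lerD2l; clear; lra.
  have h1 := near t tN1 xt.
  have h2 : `|eps * U1 t - X x| <= w.
    rewrite Xk -EU /U1 -mulrBr normrM gtr0_norm//.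
    have tN : (n0 + t <= N)%N by apply: leq_trans n1N; rewrite -N1E leq_add2l.
    have [kle|kge] := leqP k (n0 + t)%N.
      by apply: oscU; [rewrite kle|move: tk; rewrite /L; clear; lia].
    by rewrite distrC; apply: oscU; [rewrite ltnW|move: kt; rewrite /L; clear; lia].
  have : Num.min r h <= h by rewrite ge_min lexx orbT.
  have := ler_distD (eps * U1 t) (Wu x) (X x).
  by move: h0 h1 h2; rewrite /w; clear; lra.
have h20 : 0 <= 2 * h by rewrite mulr_ge0// ltW.
have cX : L2_close (delta / 8) X y by apply: lt_le_trans Xy _; rewrite lee_fin /tau0 !ge_min lexx.
have cu := L2_close_trans (l2_le_sup Iab h20 WX) cX.
split=> /=.
  apply: lt_le_trans cu _; rewrite lee_fin -/s -(mulrA 2).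
  by move: hs delta0; clear; lra.
have Wvu' : {ae lebesgue_on I, forall x, `|Wv x - Wu x| <= h}.
  by apply: ae_imply Wvu => x /le_trans; apply; rewrite ge_min lexx orbT.
have cv := L2_close_trans (l2_le_sup Iab (ltW h0) Wvu') cu.
apply: lt_le_trans cv _; rewrite lee_fin -/s -(mulrA 2).
by move: hs delta0; clear; lra.
Qed.

(** * From the two-field energy to the nonlocal energy *)

Section CellMeasures.
Context {R : realType} (I : interval R) (a b : R).
Hypothesis Iab : has_ends I a b.

Lemma lebesgue_on_initial_le (A : set R) (d : R) : measurable A -> 0 < d ->
  (forall x, A x -> x <= a + d) -> (lebesgue_on I A <= d%:E)%E.
Proof.
move=> mA d0 Ad; have [ab Ile _] := Iab.
apply: (@lebesgue_on_le _ _ _ [set` `[a, a + d]]) => //.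
- move=> x [/Ad xd /= /Ile /andP[ax _]].
  by rewrite in_itv/= ax.
- by rewrite lebesgue_measure_itv /= lte_fin ltrDl d0 -EFinB addrC addKr.
Qed.

Lemma lebesgue_on_inner (x y : R) : a <= x -> x < y -> y <= b ->
  lebesgue_on I [set` `]x, y[] = (y - x)%:E.
Proof.
move=> ax xy yb; have [_ _ abI] := Iab.
rewrite lebesgue_onE (_ : _ `&` _ = [set` `]x, y[]); last first.
  apply/seteqP; split=> z /=; first by case.
  rewrite in_itv/= => /andP[xz zy]; split; first by rewrite xz.
  by apply: abI; rewrite (le_lt_trans ax xz) (lt_le_trans zy yb).
by rewrite lebesgue_measure_itv /= lte_fin xy -EFinB.
Qed.

End CellMeasures.

(** U is controlled through V, hence only from the second node on. *)
Lemma increments_le_density {R : realType} (f : R -> R) (q : R) (U V : nat -> R)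
    (N : nat) : (forall z, 0 <= f z) -> 0 < q -> q < 1 ->
  \sum_(t < N) (U t.+2 - U t.+1) ^+ 2 <=
  (3 / chain_a q + 6 / chain_b q) * \sum_(t < N.+1) density f q U V t.
Proof.
move=> f0 q0 q1.
have a0 := chain_a_gt0 q0 q1; have b0 := chain_b_gt0 q0 q1.
have aV : 0 <= 3 / chain_a q by rewrite divr_ge0 ?ltW.
have bV : 0 <= 3 / chain_b q by rewrite divr_ge0 ?ltW.
have densge n : chain_a q * (V n.+1 - V n) ^+ 2 + chain_b q * (U n.+1 - V n.+1) ^+ 2 <=
    density f q U V n by rewrite /density /bond_quad lerDr.
have pt n : (U n.+2 - U n.+1) ^+ 2 <=
    3 / chain_a q * density f q U V n.+1 + 3 / chain_b q * density f q U V n.+1 +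
    3 / chain_b q * density f q U V n.
  have h1 : (V n.+2 - V n.+1) ^+ 2 * 3 <= 3 / chain_a q * density f q U V n.+1.
    rewrite [leLHS](_ : _ = 3 / chain_a q * (chain_a q * (V n.+2 - V n.+1) ^+ 2)).
      rewrite ler_wpM2l//; apply: le_trans (densge n.+1).
      by rewrite lerDl mulr_ge0 ?sqr_ge0 ?(ltW b0).
    by field; rewrite gt_eqF.
  have h2 k : (U k.+1 - V k.+1) ^+ 2 * 3 <= 3 / chain_b q * density f q U V k.
    rewrite [leLHS](_ : _ = 3 / chain_b q * (chain_b q * (U k.+1 - V k.+1) ^+ 2)).
      rewrite ler_wpM2l//; apply: le_trans (densge k).
      by rewrite lerDr mulr_ge0 ?sqr_ge0 ?(ltW a0).
    by field; rewrite gt_eqF.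
  apply: le_trans (_ : (V n.+2 - V n.+1) ^+ 2 * 3 + (U n.+2 - V n.+2) ^+ 2 * 3 +
    (U n.+1 - V n.+1) ^+ 2 * 3 <= _); last by rewrite !lerD.
  set x := V n.+2 - V n.+1; set y := U n.+2 - V n.+2; set z := U n.+1 - V n.+1.
  rewrite (_ : U n.+2 - U n.+1 = x + y - z); last by rewrite /x /y /z; ring.
  have := sqr_ge0 (x - y); have := sqr_ge0 (x + z); have := sqr_ge0 (y + z).
  by clear; nra.
have dens0 n : 0 <= density f q U V n by exact: density_ge0.
apply: le_trans (ler_sum _ (fun (i : 'I_N) _ => pt i)) _.
rewrite [leLHS]big_split /= [X in X + _ <= _]big_split /= -!mulr_sumr.
set S := \sum_(t < N.+1) _.
have s1 : \sum_(i < N) density f q U V i.+1 <= S.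
  exact: (@sub_sum_le R (fun n => density f q U V n) 1 N N.+1 dens0 (leqnn _)).
have s2 : \sum_(i < N) density f q U V i <= S.
  exact: (@sub_sum_le R (fun n => density f q U V n) 0 N N.+1 dens0 (leqnSn _)).
apply: (@le_trans _ _ (3 / chain_a q * S + 3 / chain_b q * S + 3 / chain_b q * S)).
  by rewrite !lerD// ler_wpM2l.
by rewrite le_eqVlt; apply/orP; left; apply/eqP; ring.
Qed.

(** The pair of fields is tiled directly, once the first node is dropped. *)
Lemma transfer_E_F {R : realType} (f : R -> R) (c sigma : R) (I : interval R)
    (a b : R) (y : L2 I) :
  (forall z, 0 <= f z) -> f 0 <= c -> 0 < sigma -> has_ends I a b ->
  transfers (@L2_pair_close R I) (fun eps => E_functional f sigma eps)
            (@L2_close R I) (fun eps => F_functional f sigma eps) y.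
Proof.
move=> f_ge0 f0c sigma_gt0 Iab M M' small MM' delta delta0.
pose q := expR (- sigma).
have q_gt0 : 0 < q by exact: expR_gt0.
have q_lt1 : q < 1 by rewrite -expR0 ltr_expR oppr_lt0.
have [ab Ile abI] := Iab.
have M0 : 0 < M.
  have [e [x [/andP[e0 _] _ Fx]]] := small 1 ltr01.
  by have := le_lt_trans (E_functional_ge0 f_ge0 sigma_gt0 x e0) Fx; rewrite lte_fin.
have a0 := chain_a_gt0 q_gt0 q_lt1; have b0 := chain_b_gt0 q_gt0 q_lt1.
have c0 : 0 <= c := le_trans (f_ge0 0) f0c.
pose r := (M' - M) / 6.
have r0 : 0 < r by rewrite divr_gt0// subr_gt0.
have [theta [K [th0 K0 const]]] :=
  tiling_constants (lexx 0) (divr_ge0 (ltW a0) (ltW b0)) c0 M0 r0.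
pose s := Num.sqrt (b - a); have s0 : 0 <= s by exact: sqrtr_ge0.
pose h := delta / (8 * (s + 1)).
have h0 : 0 < h by rewrite divr_gt0// mulr_gt0// ltr_wpDl.
have hs : h * s <= delta / 8.
  have -> : delta / 8 = h * (s + 1).
    by rewrite /h; field; rewrite gt_eqF// ltr_wpDl.
  by rewrite ler_pM2l// lerDl.
pose w := h / 8; have w0 : 0 < w by rewrite divr_gt0.
pose L := (2 * K + 2 + 4)%N.
pose A := 3 / chain_a q + 6 / chain_b q.
have A0 : 0 < A by rewrite addr_gt0// divr_gt0.
pose S := A * M.
have S0 : 0 < S by rewrite mulr_gt0.
have LS0 : 0 < L%:R * S by rewrite mulr_gt0// ltr0n /L; clear; lia.
have cK0 : 0 < c * (5 * K%:R + 2) + 1 by rewrite ltr_wpDl// mulr_ge0// addr_ge0// mulr_ge0.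
have K30 : 0 < 3 * K%:R + 5 :> R by rewrite ltr_wpDl// mulr_ge0.
have my := measurable_L2 y.
have yfin : (l2 (lebesgue_on I) y < +oo)%E by exact: Lfunction_finite.
have d80 : 0 < delta / 8 by rewrite divr_gt0.
have [sy sy0 Hy] := l2_tail_small (mu := lebesgue_on I) my yfin d80.
pose tau0 := Num.min (Num.min (delta / 8) (r / (c * (5 * K%:R + 2) + 1)))
   (Num.min (Num.min ((b - a) / (3 * K%:R + 5)) (w ^+ 2 / (L%:R * S))) (sy / 4)).
have tau0_gt0 : 0 < tau0.
  by rewrite !lt_min !divr_gt0 ?subr_gt0 ?exprn_gt0.
have [eps [[X X'] [/andP[eps0 epsT] [/= Xy _] EX]]] := small tau0 tau0_gt0.
move: (epsT); rewrite !lt_min => /andP[/andP[eps1 eps2] /andP[/andP[eps3 eps4] eps5]].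
rewrite ltr_pdivlMr// in eps2; rewrite ltr_pdivlMr// in eps3.
rewrite ltr_pdivlMr// in eps4; rewrite ltr_pdivlMr// in eps5.
have epsK : 0 <= eps * K%:R by rewrite mulr_ge0// ltW.
have e5ab : eps * 5 < b - a.
  by move: eps3 epsK; rewrite mulrDr; clear; lra.
have e2ab : 2 * eps < b - a by move: eps0 e5ab; clear; lra.
have [_ [u [v [/= pcu pcv ->]]] Eu] := ereal_inf_lt EX.
rewrite lte_fin in Eu.
(* N + 1 bonds; the profile kept starts at the second node and has N bonds. *)
have [p [[|N] [rng pI0 _ pa Nb]]] := node_range_exists Iab eps0 e2ab.
  by move: pa Nb e2ab; rewrite addr0 !mulrDr; clear; lra.
rewrite (two_field_energyE _ _ eps0 rng) in Eu.
pose U (n : nat) := u (p + n%:Z) / eps; pose V (n : nat) := v (p + n%:Z) / eps.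
rewrite -/q -/U -/V in Eu.
have EU n : eps * U n = u (p + n%:Z) by rewrite /U mulrC divfK// gt_eqF.
have NK : (3 * K + 1 < N)%N.
  rewrite -(ltr_nat R) natrD natrM -(ltr_pM2l eps0).
  by move: eps0 eps3 pa Nb; rewrite -(natr1 N) !mulrDr; clear; lra.
pose U1 t := U (1 + t)%N; pose V1 t := V (1 + t)%N.
have dens0 W Z n : 0 <= density f q W Z n by exact: density_ge0.
have osc1 : forall n n', (n' <= n <= N)%N -> (n <= n' + (2 * K + 2 + 4))%N ->
    eps * `|U1 n - U1 n'| <= w.
  apply: (oscillation_le eps0 (ltW w0) (S := S)); last by rewrite ltW.
  have := increments_le_density U V N f_ge0 q_gt0 q_lt1.
  rewrite -(ler_pM2l eps0) => /le_trans; apply.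
  by rewrite mulrCA ler_pM2l// ltW.
have nodeI k : (k <= N.+1)%N -> eps * (p + k%:Z)%:~R \in I.
  by move=> kN; suff : nodes eps I (p + k%:Z) by []; rewrite rng; exists k.
have pI : eps * (p + 1%:Z)%:~R \in I by exact: nodeI.
have NI : eps * ((p + 1%:Z)%:~R + N%:R) \in I.
  by rewrite intr_addn -addrA -natrD add1n -intr_addn; exact: nodeI.
have aH : eps * ((p + 1%:Z)%:~R - 2%:R) <= a.
  by apply: le_trans pa; rewrite ler_pM2l// intr_addn -addrA lerD2l; clear; lra.
have bH : b <= eps * ((p + 1%:Z)%:~R + N%:R + 2%:R).
  apply: (le_trans Nb); rewrite ler_pM2l// intr_addn -(natr1 N); clear; lra.
have KN1 : (0 < K < N)%N by rewrite K0; move: NK; clear; lia.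
have rh0 : 0 < Num.min r (h / 2) by rewrite lt_min r0 divr_gt0.
have [tau tau_gt0 Htau] :=
  tiling_L2 f_ge0 f0c sigma_gt0 Iab V1 eps0 pI NI aH bH KN1 th0 osc1 rh0.
exists tau => // eta /Htau[Wu [Wv [_ Fb _ near]]].
exists Wu; split; last first.
  apply: (le_trans Fb); rewrite lee_fin.
  set D := eps * _.
  have D0 : 0 <= D by rewrite /D mulr_ge0 ?(ltW eps0)//; apply: sumr_ge0.
  have DM : D <= (1 + 0 / K%:R) * M.
    rewrite mul0r addr0 mul1r; apply: le_trans (ltW Eu).
    rewrite /D ler_pM2l//.
    have := @sub_sum_le R (fun n => density f q U V n) 1 N N.+1 (fun=> dens0 _ _ _).
    move=> /(_ (leqnn _)); apply: le_trans.
    by rewrite le_eqVlt; apply/orP; left; apply/eqP; apply: eq_bigr.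
  have ecK : c * (eps * (5 * K%:R + 2)) <= r.
    by move: eps0 eps2; rewrite mulrCA !mulrDr mulr1; clear; lra.
  have := const D eps 2%N D0 DM (ltW eps0) K0 ecK.
  have : Num.min r (h / 2) <= r by rewrite ge_min lexx.
  by move: r0; rewrite (_ : M' = M + 6 * r); [clear; lra|rewrite /r; field].
have pcX := pc_extension_near Iab eps0 rng pa Nb pcu pcu.
have /andP[ap _] := Ile _ pI0.
(* S1 contains the cell of the first node; S2 has the same length and lies in the
   cells of the next ones. *)
pose S1 : set R := [set` `]-oo, a + 2 * eps]].
pose S2 : set R := [set` `]a + 2 * eps, a + 4 * eps[].
have mS1 : measurable S1 by exact: measurable_itv.
have mS2 : measurable S2 by exact: measurable_itv.
have e20 : 0 < 2 * eps by rewrite mulr_gt0.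
have muS2 : lebesgue_on I S2 = (2 * eps)%:E.
  rewrite (lebesgue_on_inner Iab); [congr _%:E; clear; ring| | |];
  by move: eps0 e5ab; clear; lra.
have muS1 : (lebesgue_on I S1 <= (2 * eps)%:E)%E.
  by apply: (lebesgue_on_initial_le Iab) => // x; rewrite /S1/= in_itv.
have S12 : (lebesgue_on I S1 <= lebesgue_on I S2)%E by rewrite muS2.
have cells : {ae lebesgue_on I, forall x, [/\ ~ S1 x -> `|Wu x - X x| <= h,
    S1 x -> `|Wu x - eps * U1 0%N| <= h & S2 x -> `|X x - eps * U1 0%N| <= h]}.
  apply: ae_imply2 near pcX => x [xI near] [_ [k kN [xk Xk _]]].
  have /andP[ax xb] := Ile _ xI.
  have mh : 3 * w + Num.min r (h / 2) <= h.
    have : Num.min r (h / 2) <= h / 2 by rewrite ge_min lexx orbT.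
    by move: h0; rewrite /w; clear; lra.
  have late : a + 2 * eps < x -> exists k', k = k'.+1.
    case: k kN xk Xk => [_ xk _ ax2|k' _ _ _ _]; last by exists k'.
    move: xk; rewrite ler_distl addr0 => /andP[_ xk].
    by move: xk pa ax2; rewrite !mulrDr; clear; lra.
  have node1 k' : (p + 1%:Z)%:~R + k'%:R = p%:~R + k'.+1%:R :> R.
    by rewrite intr_addn -(natr1 k'); ring.
  split=> [nS1|S1x|S2x].
  - have xa : a + 2 * eps < x by move: nS1; rewrite /S1/= in_itv/= => /negP; rewrite -ltNge.
    have [k' kE] := late xa; rewrite {}kE in kN xk Xk.
    rewrite Xk -EU -(add1n k'); apply: le_trans mh; apply: near => //.
    rewrite node1; apply: (le_trans xk); rewrite ler_peMl ?(ltW eps0)//; clear; lra.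
  - apply: le_trans mh; apply: near => //; rewrite node1 ler_distl.
    move: S1x; rewrite /S1/= in_itv/= => S1x; apply/andP; split.
      by move: S1x pa ap ax eps0; rewrite !(mulrDr, mulrDl); clear; lra.
    by move: S1x pa ap ax eps0; rewrite !(mulrDr, mulrDl); clear; lra.
  - move: S2x; rewrite /S2/= in_itv/= => /andP[xa xa4].
    have [k' kE] := late xa; rewrite {}kE in kN xk Xk.
    rewrite Xk -EU -(add1n k') -mulrBr normrM gtr0_norm//.
    have k4 : (k' < 4)%N.
      rewrite -(ltr_nat R) -(ltr_pM2l eps0); move: xk; rewrite ler_distl => /andP[xk _].
      move: xk; rewrite -(natr1 k') !mulrDr => xk.
      by move: xk ap xa4; clear; lra.
    apply: (@le_trans _ _ w).
      by apply: osc1; [rewrite leq0n|move: k4; clear; lia].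
    by move: h0; rewrite /w; clear; lra.
have [ab0 ba0] : 0 <= b - a /\ (lebesgue_on I setT <= (b - a)%:E)%E.
  by split; [rewrite subr_ge0 ltW | exact: lebesgue_on_itvT].
have := l2_split_cell (mu := lebesgue_on I) mS1 mS2 (measurable_L2 Wu)
  (measurable_L2 X) my (ltW h0) ab0 ba0 _ cells.
rewrite -/s => /(_ S12) bound; apply: le_lt_trans bound _.
have cX : (l2 (lebesgue_on I) (fun x => (X x - y x)%R) <= (delta / 8)%:E)%E.
  by apply: ltW; apply: lt_le_trans Xy _; rewrite lee_fin /tau0 !ge_min lexx.
have sm : 2 * eps < sy by move: eps0 eps5; clear; lra.
have y1 := Hy S1 mS1 (le_lt_trans muS1 (ltac:(by rewrite lte_fin) : ((2 * eps)%:E < sy%:E)%E)).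
have y2 := Hy S2 mS2 (ltac:(by rewrite muS2 lte_fin) : (lebesgue_on I S2 < sy%:E)%E).
pose d8 := delta / 8.
apply: (@le_lt_trans _ _ (2%:E * d8%:E + 2%:E * d8%:E + (d8%:E + d8%:E))%E).
  apply: leeD; [apply: leeD|apply: leeD].
  - by rewrite -!EFinM lee_fin ler_pM2l.
  - by rewrite lee_pmul2l// lte_fin.
  - exact: ltW.
  - exact: ltW.
rewrite -!EFinM -!EFinD lte_fin /d8; move: delta0; clear; lra.
Qed.

(** * The common Gamma-limit *)

Section L2Convergence.
Context {R : realType} (I : interval R).

Lemma L2_cvgP (u : nat -> L2 I) (l : L2 I) :
  L2_cvg u l <-> forall delta, 0 < delta -> \forall k \near \oo, L2_close delta (u k) l.
Proof.
split=> [ul delta d0|ul].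
  have : nbhs (0 : \bar R)%E [set x | (x < delta%:E)%E].
    by apply: open_nbhs_nbhs; split; [exact: open_ereal_lt_ereal | rewrite /= lte_fin].
  by move=> /ul.
apply: limn_esup_le_cvg; last by move=> n; exact: l2_ge0.
apply/lee_addgt0Pr => r r0; rewrite add0e; apply: limn_esup_le.
by have [m _ Hm] := ul r r0; exists m => // k /Hm /ltW.
Qed.

Lemma L2_pair_cvgP (W : nat -> L2 I * L2 I) (l : L2 I) :
  L2_pair_cvg W l <-> forall delta, 0 < delta -> \forall k \near \oo, L2_pair_close delta (W k) l.
Proof.
rewrite /L2_pair_cvg !L2_cvgP; split=> [[W1 W2] d d0|W12].
  exact: filterI (W1 d d0) (W2 d d0).
by split=> d d0; have [m _ Hm] := W12 d d0; exists m => // k /Hm [].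
Qed.

Lemma L2_close_refl (delta : R) (y : L2 I) : 0 < delta -> L2_close delta y y.
Proof.
move=> d0; rewrite /L2_close (_ : (fun x => _) = cst 0).
  by rewrite /l2 Lnorm0 ?lte_fin// eqe pnatr_eq0.
by apply/funext => x; rewrite subrr.
Qed.

Lemma L2_close_mono (d d' : R) (x y : L2 I) : d <= d' -> L2_close d x y -> L2_close d' x y.
Proof. by move=> dd' /lt_le_trans; apply; rewrite lee_fin. Qed.

End L2Convergence.

Lemma has_ends_inf_sup {R : realType} (I : interval R) :
  bounded_set [set` I] -> (exists x y, [/\ x \in I, y \in I & x < y]) ->
  has_ends I (inf [set` I]) (sup [set` I]).
Proof.
move=> bI [x0 [y0 [x0I y0I xy0]]].
have [M HM] : exists M, forall x, x \in I -> `|x| <= M.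
  by have [M [_ HM]] := bI; exists (M + 1) => x xI; apply: HM => //; rewrite ltrDl.
have ne : [set` I] !=set0 by exists x0.
have hu : has_sup [set` I].
  by split=> //; exists M => x /= /HM; rewrite ler_norml => /andP[].
have hl : has_inf [set` I].
  by split=> //; exists (- M) => x /= /HM; rewrite ler_norml => /andP[].
have le_sup x : x \in I -> x <= sup [set` I] by move=> xI; exact: (sup_upper_bound hu).
have inf_le x : x \in I -> inf [set` I] <= x by move=> xI; exact: (ge_inf hl.2).
split.
- exact: le_lt_trans (inf_le _ x0I) (lt_le_trans xy0 (le_sup _ y0I)).
- by move=> x xI; rewrite inf_le//= le_sup.
move=> x /andP[ax xb].
have [u uI ux] := inf_lt ne ax.
have [v vI xv] := sup_gt ne xb.
by apply: (interval_is_interval uI vI); rewrite !ltW.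
Qed.

(** On an interval with at most one point there are no bonds, and all functions
    are equal almost everywhere. *)
Lemma Gamma_cvg_degenerate {R : realType} (f : R -> R) (sigma : R) (I : interval R) :
  (forall z, 0 <= f z) -> 0 < sigma ->
  (forall x y, x \in I -> y \in I -> x = y) ->
  Gamma_cvg (@L2_cvg R I) (@F_functional R f sigma I) (fun=> 0%E) /\
  Gamma_cvg (@L2_pair_cvg R I) (@E_functional R f sigma I) (fun=> 0%E).
Proof.
move=> f_ge0 sigma_gt0 uniq_pt.
have null : lebesgue_measure [set` I] = 0%E.
  apply: countable_lebesgue_measure0.
  have [[x xI]|no] := pselect (exists x, x \in I).
    apply: (@sub_countable _ _ _ [set x]) => //; apply: subset_card_le => y yI.
    exact: uniq_pt yI xI.
  apply: (@sub_countable _ _ _ set0) => //; apply: subset_card_le => y yI.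
  by apply: no; exists y.
have ae0 (P : R -> Prop) : {ae lebesgue_on I, forall x, P x}.
  exists setT; split=> //; by rewrite lebesgue_onE setTI.
have no_bonds eps : 0 < eps -> bonds eps I = set0.
  move=> e0; apply/seteqP; split=> // i [iI i1I].
  have /(congr1 (fun z => z / eps)) := uniq_pt _ _ iI i1I.
  rewrite ![eps * _]mulrC !mulfK ?gt_eqF// => /eqP.
  by rewrite eqr_int; lia.
pose o (i : int) : R := 0.
have F0 eps (U : L2 I) : 0 < eps -> (F_functional f sigma eps U <= 0)%E.
  move=> e0; apply: ereal_inf_lbound; exists o; split; first exact: ae0.
  rewrite /nonlocal_energy /local_energy no_bonds// fsbig_set0 mulr0 add0r.
  rewrite fsbig1 ?mulr0// => i _; rewrite fsbig1// => j _.
  by rewrite subrr mul0r expr0n mulr0.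
have E0 eps (W : L2 I * L2 I) : 0 < eps -> (E_functional f sigma eps W <= 0)%E.
  move=> e0; apply: ereal_inf_lbound; exists o, o; split; [exact: ae0|exact: ae0|].
  by rewrite /two_field_energy /local_energy no_bonds// !fsbig_set0 !mulr0 !addr0.
split=> eps eps0 _ y; split.
- move=> x _; apply: le_limn_einf; apply: nearW => k.
  exact: F_functional_ge0.
- exists (fun=> y); split; last by apply: limn_esup_le; apply: nearW => k; exact: F0.
  by apply/L2_cvgP => d d0; apply: nearW => k; exact: L2_close_refl.
- move=> x _; apply: le_limn_einf; apply: nearW => k.
  exact: E_functional_ge0.
- exists (fun=> (y, y)); split; last by apply: limn_esup_le; apply: nearW => k; exact: E0.
  by apply/L2_pair_cvgP => d d0; apply: nearW => k; split; exact: L2_close_refl.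
Qed.

Lemma Gamma_cvg_has_ends {R : realType} (f : R -> R) (c sigma : R) (I : interval R)
    (a b : R) :
  (forall z, 0 <= f z) -> f 0 <= c -> 0 < sigma -> has_ends I a b ->
  let G := lower_limit (@L2_close R I) (@F_functional R f sigma I) in
  Gamma_cvg (@L2_cvg R I) (@F_functional R f sigma I) G /\
  Gamma_cvg (@L2_pair_cvg R I) (@E_functional R f sigma I) G.
Proof.
move=> f_ge0 f0c sigma_gt0 Iab G.
have F0 eps (U : L2 I) : 0 < eps -> (0 <= F_functional f sigma eps U)%E.
  exact: F_functional_ge0.
have E0 eps (W : L2 I * L2 I) : 0 < eps -> (0 <= E_functional f sigma eps W)%E.
  exact: E_functional_ge0.
have FE y := @transfer_F_E R f c sigma I a b y f_ge0 f0c sigma_gt0 Iab.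
have EF y := @transfer_E_F R f c sigma I a b y f_ge0 f0c sigma_gt0 Iab.
have GE y : lower_limit (@L2_pair_close R I) (@E_functional R f sigma I) y = G y.
  apply/eqP; rewrite eq_le (lower_limit_transfer (FE y) F0).
  exact: (lower_limit_transfer (EF y) E0).
split=> eps eps0 epsc y; split.
- by move=> x /L2_cvgP xy; exact: lower_limit_liminf.
- have [x [xy lim]] := recovery_sequence (EF y) E0 eps0 epsc
    (fun d d0 => L2_close_refl y d0) (fun d d' x dd' => L2_close_mono dd').
  exists x; split; first by apply/L2_cvgP.
  by rewrite -GE.
- by move=> x /L2_pair_cvgP xy; rewrite -GE; exact: lower_limit_liminf.
- have [x [xy lim]] := @recovery_sequence _ _ _ _ _ _ _ _ _ (FE y) F0 eps (y, y) eps0 epsc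
    (fun d d0 => conj (L2_close_refl y d0) (L2_close_refl y d0))
    (fun d d' x dd' h => conj (L2_close_mono dd' h.1) (L2_close_mono dd' h.2)).
  by exists x; split; first by apply/L2_pair_cvgP.
Qed.

Theorem theorem5p6 (R : realType) (f : R -> R) (c sigma : R) (I : interval R)
    (hc : 0 < c)
    (hf : forall z : R, 0 <= f z /\ f z <= c * (z ^+ 2 + 1))
    (hsigma : 0 < sigma)
    (hI : bounded_set [set` I]) :
  exists G : L2 I -> \bar R,
    Gamma_cvg (@L2_cvg R I) (@F_functional R f sigma I) G /\
    Gamma_cvg (@L2_pair_cvg R I) (@E_functional R f sigma I) G.
Proof.
have f_ge0 z : 0 <= f z by have [] := hf z.
have f0c : f 0 <= c by have [_] := hf 0; rewrite expr0n add0r mulr1.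
have [two_pts|one_pt] := pselect (exists x y, [/\ x \in I, y \in I & x < y]).
  by eexists; exact: Gamma_cvg_has_ends f_ge0 f0c hsigma (has_ends_inf_sup hI two_pts).
exists (fun=> 0%E); apply: Gamma_cvg_degenerate => // x y xI yI.
by case: (ltgtP x y) => // lt; case: one_pt; [exists x, y|exists y, x].
Qed.
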